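(* Let $(X,\rho_X)$ and $(Y,\rho_Y)$ be compact metric spaces, let $\rho$ be a metric on the disjoint union $Z=X\,\dot\cup\,Y$ whose restrictions to $X$ and $Y$ are $\rho_X$ and $\rho_Y$, and let $n$ be a positive integer. Let $r\in\mathbb R^+$ be given. Let $\varepsilon$ be small enough that $\varepsilon\lambda_nr<1/14$. Set $s=\lambda_nr(1-12\varepsilon\lambda_nr)^{-1}$, so that $\varepsilon s<1/2$. Finally, assume that $\mathrm{dist}_H^\rho(X,Y)<\varepsilon$. Let $p_0$ and $p_1$ be projections in $\mathcal P_n^r(X)$ which lie in the same path component of $\mathcal P_n^r(X)$. Then there exist $q_0,q_1\in\mathcal P_n^s(Y)$ such that $L(p_j\oplus q_j)<s$ for $j=0,1$. For any such $q_0$ and $q_1$ and for any $\delta$ with $2\varepsilon s<\delta<1$ there exist a path $p$ in $\mathcal P_n(X)$ going from $p_0$ to $p_1$ and a path $q$ in $\mathcal P_n(Y)$ going from $q_0$ to $q_1$ such that $$L(p_t\oplus q_t)<(1-\delta)^{-1}s$$ for all $t$. In particular, the vector bundles on $Y$ determined by $q_0$ and $q_1$ are isomorphic.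
   Context: For a compact metric space $(W,\rho)$, $C(W)$ is the algebra of continuous complex-valued functions, and $M_n(C(W))$ is viewed as the algebra of continuous functions from $W$ to $M_n(\mathbb C)$ (operator norm on $\mathbb C^n$), with norm $\|a\|=\sup_w\|a(w)\|$ and pointwise adjoint. $L(a)=\sup\{\|a(x)-a(y)\|/\rho(x,y):x\neq y\}\in[0,\infty]$. A projection is an element $p$ with $p=p^2=p^*$; it determines the vector bundle on $W$ whose fiber at $x$ is $p(x)\mathbb C^n$. $\mathcal P_n(W)$ is the set of projections $p\in M_n(C(W))$ with $L(p)<\infty$, and $\mathcal P_n^r(W)=\{p\in\mathcal P_n(W):L(p)<r\}$. For $Z=X\,\dot\cup\,Y$, $p\oplus q$ is the function on $Z$ equal to $p$ on $X$ and $q$ on $Y$, and $L(p\oplus q)$ is computed with $\rho$. $\mathrm{dist}_H^\rho(X,Y)$ is the Hausdorff distance between $X$ and $Y$ in $(Z,\rho)$. A path is a norm-continuous function with domain $[0,1]$; path components are for the norm topology. Let $M_n^s(\mathbb C)$ be the real Banach space of self-adjoint matrices with the operator norm. For a function $F$ on $X\times T$ write $F_t$ for $x\mapsto F(x,t)$. The constant $\lambda_n$ is the smallest constant $c$ such that for every compact metric space $Z$, every closed subset $X$ of $Z$, every compact space $T$, and every continuous $F:X\times T\to M_n^s(\mathbb C)$ for which there is a constant $N$ with $L(F_t)\le N$ for all $t$, there is a continuous extension $G:Z\times T\to M_n^s(\mathbb C)$ of $F$ with $L(G_t)\le cN$ for all $t$ and $\|G\|_\infty=\|F\|_\infty$.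 *)

(* Defs.v *)
From HB Require Import structures.
From mathcomp Require Import all_boot all_order all_algebra spectral.
From mathcomp Require Import complex.
From mathcomp Require Import all_classical all_reals all_analysis.

Set Implicit Arguments.
Unset Strict Implicit.
Unset Printing Implicit Defensive.

Import Order.TTheory GRing.Theory Num.Theory.
Import numFieldTopology.Exports.

Local Open Scope classical_set_scope.
Local Open Scope complex_scope.
Local Open Scope sesquilinear_scope.
Local Open Scope ring_scope.

Section Norms.
Context {R : realType}.

Definition cvnorm (n : nat) (v : 'cV[R[i]]_n) : R :=
  Num.sqrt (\sum_(i < n) ComplexField.Normc.normc (v i 0) ^+ 2).

Definition opnorm (n : nat) (A : 'M[R[i]]_n) : R :=
  sup [set cvnorm (A *m v) | v in [set v | cvnorm v <= 1]].

Definition selfadjoint (n : nat) (A : 'M[R[i]]_n) : Prop := A ^t* = A.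

(* The library puts no topology on [R[i]], so continuity of matrix-valued
   functions is expressed with the operator norm. *)
Definition mx_continuous_on (W : topologicalType) (n : nat) (D : set W)
    (f : W -> 'M[R[i]]_n) : Prop :=
  forall x, D x -> forall e : R, 0 < e ->
    \forall y \near within D (nbhs x), opnorm (f y - f x) < e.

(* In [supnorm] and [lip] the value 0 is adjoined because the suprema are taken
   in [0, +oo]; it matters only when the indexing set is empty. *)
Definition supnorm (W : Type) (n : nat) (D : set W)
    (a : W -> 'M[R[i]]_n) : \bar R :=
  ereal_sup (0%E |` [set (opnorm (a w))%:E | w in D]).

Definition lip (W : Type) (n : nat) (d : W -> W -> R) (D : set W)
    (a : W -> 'M[R[i]]_n) : \bar R :=
  ereal_sup (0%E |`
    [set (opnorm (a xy.1 - a xy.2) / d xy.1 xy.2)%:E |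
      xy in [set xy : W * W | [/\ D xy.1, D xy.2 & xy.1 <> xy.2]]]).

End Norms.

Section Metrics.
Context {R : realType}.

Definition is_metric (W : Type) (d : W -> W -> R) : Prop :=
  [/\ forall x, d x x = 0,
      forall x y, d x y = 0 -> x = y,
      forall x y, d x y = d y x &
      forall x y z, d x z <= d x y + d y z].

(* The value is +oo when exactly one of A and B is empty. *)
Definition hausdorff_dist (W : Type) (d : W -> W -> R) (A B : set W) : \bar R :=
  ereal_inf [set e%:E | e in [set e : R |
    [/\ 0 < e,
        forall x, A x -> exists2 y, B y & d x y < e &
        forall y, B y -> exists2 x, A x & d x y < e]]].

End Metrics.

Section ExtensionConstant.
Variable R : realType.

(* Only the values of F on X x T are used. *)
Definition extension_constant (n : nat) (c : R) : Prop :=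
  forall (Z : metricType R) (X : set Z) (T : topologicalType)
         (F : Z * T -> 'M[R[i]]_n) (N : R),
    compact [set: Z] -> closed X -> compact [set: T] ->
    mx_continuous_on (X `*` [set: T]) F ->
    (forall x t, X x -> selfadjoint (F (x, t))) ->
    (forall t, (lip mdist X (fun x => F (x, t)) <= N%:E)%E) ->
    exists G : Z * T -> 'M[R[i]]_n,
      [/\ mx_continuous_on [set: Z * T] G,
          forall z t, selfadjoint (G (z, t)),
          forall x t, X x -> G (x, t) = F (x, t),
          forall t, (lip mdist [set: Z] (fun z => G (z, t)) <= (c * N)%:E)%E &
          supnorm [set: Z * T] G = supnorm (X `*` [set: T]) F].

(* Stated with an infimum, so that the existence of a least constant is not
   presupposed; it is the smallest constant whenever there is one. *)
Definition lambda (n : nat) : R := inf [set c | extension_constant n c].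

End ExtensionConstant.
Arguments lambda {R} n.

Section Projections.
Context {R : realType}.

Definition is_projection (W : topologicalType) (n : nat)
    (p : W -> 'M[R[i]]_n) : Prop :=
  [/\ mx_continuous_on [set: W] p,
      forall x, p x *m p x = p x &
      forall x, selfadjoint (p x)].

Definition Proj (W : metricType R) (n : nat) : set (W -> 'M[R[i]]_n) :=
  [set p | is_projection p /\ (lip mdist [set: W] p < +oo)%E].

Definition ProjLt (W : metricType R) (n : nat) (r : R) :
    set (W -> 'M[R[i]]_n) :=
  [set p | @Proj W n p /\ (lip mdist [set: W] p < r%:E)%E].

(* A path is given by a function on R of which only the values on [0, 1] are
   used; continuity is for the norm of M_n(C(W)). *)
Definition is_path_in (W : Type) (n : nat) (S : set (W -> 'M[R[i]]_n))
    (p0 p1 : W -> 'M[R[i]]_n) (p : R -> W -> 'M[R[i]]_n) : Prop :=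
  [/\ p 0 = p0, p 1 = p1,
      forall t : R, t \in `[0, 1] -> S (p t) &
      forall t : R, t \in `[0, 1] -> forall e : R, 0 < e ->
        \forall u \near within `[0, 1] (nbhs t),
          (supnorm [set: W] (p u \- p t)%R < e%:E)%E].

Definition same_path_component (W : Type) (n : nat)
    (S : set (W -> 'M[R[i]]_n)) (p0 p1 : W -> 'M[R[i]]_n) : Prop :=
  exists p, is_path_in S p0 p1 p.

Definition dsum (X Y : Type) (n : nat) (p : X -> 'M[R[i]]_n)
    (q : Y -> 'M[R[i]]_n) (z : X + Y) : 'M[R[i]]_n :=
  match z with inl x => p x | inr y => q y end.

End Projections.

Section Bundles.
Context {R : realType}.

Definition fiber (W : Type) (n : nat) (p : W -> 'M[R[i]]_n) (x : W) :
    set 'cV[R[i]]_n := range (fun v : 'cV[R[i]]_n => p x *m v).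

(* A map of bundles over the identity of W: fibrewise linear, and continuous on
   the total space {(x, v) | v in p(x) C^n}, a subspace of W x C^n. *)
Definition bundle_map (W : topologicalType) (n : nat) (p q : W -> 'M[R[i]]_n)
    (phi : W -> 'cV[R[i]]_n -> 'cV[R[i]]_n) : Prop :=
  [/\ forall x v, fiber p x v -> fiber q x (phi x v),
      forall x (a : R[i]) u v, fiber p x u -> fiber p x v ->
        phi x (a *: u + v) = a *: phi x u + phi x v &
      forall x v, fiber p x v -> forall e : R, 0 < e ->
        exists2 d : R, 0 < d &
          \forall y \near x, forall w, fiber p y w ->
            cvnorm (w - v) < d -> cvnorm (phi y w - phi x v) < e].

Definition bundle_isomorphic (W : topologicalType) (n : nat)
    (p q : W -> 'M[R[i]]_n) : Prop :=
  exists phi psi,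
    [/\ bundle_map p q phi, bundle_map q p psi,
        forall x v, fiber p x v -> psi x (phi x v) = v &
        forall x v, fiber q x v -> phi x (psi x v) = v].

End Bundles.

(* Main.v *)
Require Import Defs.
From HB Require Import structures.
From mathcomp Require Import all_boot all_order all_algebra spectral complex.
From mathcomp Require Import all_classical all_reals all_analysis.
From mathcomp Require Import ring lra.

Set Implicit Arguments.
Unset Strict Implicit.
Unset Printing Implicit Defensive.

Import Order.TTheory GRing.Theory Num.Theory.
Import numFieldTopology.Exports.

Local Open Scope classical_set_scope.
Local Open Scope complex_scope.
Local Open Scope sesquilinear_scope.
Local Open Scope ring_scope.

(** Let [Z] be the disjoint union of [X] and [Y], with the metric [rho]. The path
    from [p0] to [p1] is a function on [X x [0, 1]] with values in the self-adjoint
    matrices, whose Lipschitz constants in [X] are at most [r]. By the definition of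
    [lambda n] it extends to [Z x [0, 1]] with Lipschitz constants at most [c r],
    for any [c > lambda n]. Every point of [Y] is within some [e < eps] of [X], so
    the values of the extension are within [d = c r e < 1/2] of projections.

    Such a matrix can be rounded to its spectral projection for the eigenvalues
    near 1 (spectral_rounding), and rounding is Lipschitz with constant
    [1 / (1 - 2 d)] (near_proj_lip). Rounding the extension therefore gives a path
    of projections on [Z] that restricts to the given path on [X], with Lipschitz
    constants less than [s] (lift_path): the number 12 in the definition of [s]
    leaves room both for the factor 2 and for choosing [c] larger than [lambda n].
    The ends of this path, restricted to [Y], are projections as required of [q0]
    and [q1].

    If other [q0] and [q1] are given, then they differ from those ends by at most
    [2 e s < 1], because both are close to [p0], respectively [p1], at a nearby
    point of [X]. On the segment between two projections at distance [D < 1] every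
    point is within [D / 2] of one of the ends, so the segment can be rounded too,
    at the cost of a factor [1 / (1 - D)] (close_lip_proj_path). Joining the three
    paths gives the second assertion. Finally, projection-valued functions that are
    uniformly close have isomorphic bundles, and a path is made of short steps
    (bundle_isomorphic_path).

    All this requires that [lambda n] is positive and is approached by actual
    extension constants, hence that extension constants exist
    (extension_constant_exists). They do by McShane's formula
    [inf_x (f x + N rho (x, z))], applied to the real and imaginary parts of the
    entries and followed by a retraction onto a ball. *)

(** * Vector norm and operator norm *)

Local Notation normc := ComplexField.Normc.normc.

Section VectorNorm.
Context {R : realType}.
Implicit Types (n : nat).

Lemma normc_ge0 (a : R[i]) : 0 <= normc a.
Proof. by case: a => x y; rewrite sqrtr_ge0. Qed.

Lemma cvnorm_ge0 n (v : 'cV[R[i]]_n) : 0 <= cvnorm v.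
Proof. exact: sqrtr_ge0. Qed.

Lemma cvnorm_sqr n (v : 'cV[R[i]]_n) :
  cvnorm v ^+ 2 = \sum_(i < n) normc (v i 0) ^+ 2.
Proof. by rewrite sqr_sqrtr// sumr_ge0// => i _; rewrite sqr_ge0. Qed.

Lemma cvnorm_le_of_sqr n (v : 'cV[R[i]]_n) (c : R) :
  0 <= c -> cvnorm v ^+ 2 <= c ^+ 2 -> cvnorm v <= c.
Proof. by move=> c0; rewrite ler_pXn2r// nnegrE ?cvnorm_ge0. Qed.

Lemma normc_le_cvnorm n (v : 'cV[R[i]]_n) i : normc (v i 0) <= cvnorm v.
Proof.
rewrite -(@ler_pXn2r _ 2)// ?nnegrE ?normc_ge0 ?cvnorm_ge0//.
rewrite cvnorm_sqr (bigD1 i)//= lerDl sumr_ge0// => j _; exact: sqr_ge0.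
Qed.

Lemma cvnorm_eq0 n (v : 'cV[R[i]]_n) : cvnorm v <= 0 -> v = 0.
Proof.
move=> v0; apply/matrixP => i j; rewrite ord1 mxE.
apply: ComplexField.Normc.eq0_normc; apply/eqP.
by rewrite eq_le normc_ge0 andbT (le_trans (normc_le_cvnorm v i)).
Qed.

Lemma cvnorm0 n : cvnorm (0 : 'cV[R[i]]_n) = 0.
Proof.
by rewrite /cvnorm big1 ?sqrtr0// => i _; rewrite mxE ComplexField.Normc.normc0 expr0n.
Qed.

Lemma cvnormZ n (a : R[i]) (v : 'cV[R[i]]_n) :
  cvnorm (a *: v) = normc a * cvnorm v.
Proof.
rewrite /cvnorm -[normc a]ger0_norm ?normc_ge0// -sqrtr_sqr -sqrtrM ?sqr_ge0//.
congr Num.sqrt; rewrite mulr_sumr; apply: eq_bigr => i _.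
by rewrite mxE ComplexField.Normc.normcM exprMn.
Qed.

Lemma cvnormN n (v : 'cV[R[i]]_n) : cvnorm (- v) = cvnorm v.
Proof. by rewrite -scaleN1r cvnormZ normcN ComplexField.Normc.normc1 mul1r. Qed.

(** Convexity of the square: with [s] and [t] the two norms,
    [(a + b)^2 <= (s + t) * (a^2 / s + b^2 / t)] coordinatewise, and the
    right-hand sides add up to [(s + t)^2]. *)
Lemma cvnormD n (u v : 'cV[R[i]]_n) : cvnorm (u + v) <= cvnorm u + cvnorm v.
Proof.
have [/cvnorm_eq0 ->|s0] := leP (cvnorm u) 0; first by rewrite cvnorm0 !add0r.
have [/cvnorm_eq0 ->|t0] := leP (cvnorm v) 0; first by rewrite cvnorm0 !addr0.
set s := cvnorm u in s0 *; set t := cvnorm v in t0 *.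
apply: cvnorm_le_of_sqr; first by rewrite addr_ge0 ?ltW.
have -> : (s + t) ^+ 2 = (s + t) / s * s ^+ 2 + (s + t) / t * t ^+ 2.
  by field; rewrite !gt_eqF.
rewrite !cvnorm_sqr !mulr_sumr -big_split/=; apply: ler_sum => i _.
rewrite mxE; set a := normc (u i 0); set b := normc (v i 0).
apply: (@le_trans _ _ ((a + b) ^+ 2)).
  rewrite ler_pXn2r ?nnegrE ?normc_ge0 ?addr_ge0 ?normc_ge0//.
  exact: le_normcD.
rewrite -subr_ge0.
have -> : (s + t) / s * a ^+ 2 + (s + t) / t * b ^+ 2 - (a + b) ^+ 2 =
  (t * a - s * b) ^+ 2 / (s * t) by field; rewrite !gt_eqF.
by rewrite divr_ge0 ?sqr_ge0// mulr_ge0 ?ltW.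
Qed.

Lemma cvnorm_sum_le n (v : 'cV[R[i]]_n) : cvnorm v <= \sum_i normc (v i 0).
Proof.
have S0 : 0 <= \sum_i normc (v i 0).
  by rewrite sumr_ge0// => i _; exact: normc_ge0.
apply: cvnorm_le_of_sqr => //.
rewrite cvnorm_sqr [leRHS]expr2 mulr_suml; apply: ler_sum => i _.
rewrite expr2 ler_wpM2l ?normc_ge0// (bigD1 i)//= lerDl.
by rewrite sumr_ge0// => j _; exact: normc_ge0.
Qed.

(** The link with the adjoint, through which orthogonality is used. *)
Lemma cvnorm_sqrC n (v : 'cV[R[i]]_n) :
  ((cvnorm v) ^+ 2)%:C = (v ^t* *m v) 0 0.
Proof.
rewrite cvnorm_sqr mxE rmorph_sum; apply: eq_bigr => i _ /=.
rewrite !mxE mulrC -normCK.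
by case: (v i 0) => x y; rewrite normc_def /= rmorphXn.
Qed.

End VectorNorm.

Section OperatorNorm.
Context {R : realType} {n : nat}.
Implicit Types (A B : 'M[R[i]]_n) (v : 'cV[R[i]]_n).

Definition entry_sum A : R := \sum_i \sum_j normc (A i j).

Lemma cvnorm_mulmx_entry A v : cvnorm (A *m v) <= entry_sum A * cvnorm v.
Proof.
rewrite (le_trans (cvnorm_sum_le _))// mulr_suml; apply: ler_sum => i _.
rewrite mxE mulr_suml.
elim/big_ind2 : _ => [|a b c d ab cd|j _].
- by rewrite ComplexField.Normc.normc0.
- by rewrite (le_trans (le_normcD _ _))// lerD.
- by rewrite ComplexField.Normc.normcM ler_wpM2l ?normc_ge0 ?normc_le_cvnorm.
Qed.

Let opnorm_has_sup A :
  has_sup [set cvnorm (A *m v) | v in [set v : 'cV[R[i]]_n | cvnorm v <= 1]].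
Proof.
split; first by exists (cvnorm (A *m 0)), 0 => //=; rewrite cvnorm0.
exists (entry_sum A) => _ [v /= v1 <-]; rewrite (le_trans (cvnorm_mulmx_entry _ _))//.
rewrite ler_piMr// sumr_ge0// => i _; rewrite sumr_ge0// => j _.
exact: normc_ge0.
Qed.

Lemma opnorm_ge0 A : 0 <= opnorm A.
Proof.
apply: sup_upper_bound (opnorm_has_sup A) _ _.
by exists 0; rewrite /= ?mulmx0 ?cvnorm0.
Qed.

Lemma cvnorm_mulmx A v : cvnorm (A *m v) <= opnorm A * cvnorm v.
Proof.
have [/cvnorm_eq0 ->|v0] := leP (cvnorm v) 0; first by rewrite mulmx0 cvnorm0 mulr0.
have nv : normc ((cvnorm v)^-1)%:C = (cvnorm v)^-1.
  by rewrite /= expr0n addr0 sqrtr_sqr ger0_norm// invr_ge0 ltW.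
rewrite -ler_pdivrMr// mulrC -nv -cvnormZ scalemxAr.
apply: sup_upper_bound (opnorm_has_sup A) _ _; exists (((cvnorm v)^-1)%:C *: v) => //=.
by rewrite cvnormZ nv mulVf ?gt_eqF.
Qed.

Lemma opnorm_leP A (c : R) : 0 <= c ->
  (forall v, cvnorm (A *m v) <= c * cvnorm v) -> opnorm A <= c.
Proof.
move=> c0 H; apply: ge_sup; first by case: (opnorm_has_sup A).
by move=> _ [v /= v1 <-]; rewrite (le_trans (H v))// ler_piMr.
Qed.

Lemma opnormN A : opnorm (- A) = opnorm A.
Proof.
rewrite /opnorm; congr sup; apply: eq_imagel => v _.
by rewrite mulNmx cvnormN.
Qed.

Lemma opnorm_le_entry A : opnorm A <= entry_sum A.
Proof.
apply: opnorm_leP; last exact: cvnorm_mulmx_entry.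
by rewrite sumr_ge0// => i _; rewrite sumr_ge0// => j _; exact: normc_ge0.
Qed.

Lemma normc_le_opnorm A i j : normc (A i j) <= opnorm A.
Proof.
have := cvnorm_mulmx A (delta_mx j 0); rewrite -colE.
have -> : cvnorm (delta_mx j 0 : 'cV[R[i]]_n) = 1.
  apply/eqP; rewrite -(@eqrXn2 _ 2) ?cvnorm_ge0// cvnorm_sqr (bigD1 j)//=.
  rewrite big1 ?addr0 => [|k kj].
    by rewrite mxE !eqxx ComplexField.Normc.normc1.
  by rewrite mxE (negbTE kj) ComplexField.Normc.normc0 expr0n.
rewrite mulr1; apply: le_trans.
have -> : A i j = col j A i 0 by rewrite mxE.
exact: normc_le_cvnorm.
Qed.

Lemma opnorm_eq0 A : opnorm A <= 0 -> A = 0.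
Proof.
move=> A0; apply/matrixP => i j; rewrite mxE.
apply: ComplexField.Normc.eq0_normc; apply/eqP; rewrite eq_le normc_ge0 andbT.
exact: le_trans (normc_le_opnorm A i j) A0.
Qed.

Lemma opnorm0 : opnorm (0 : 'M[R[i]]_n) = 0.
Proof.
apply/eqP; rewrite eq_le opnorm_ge0 andbT; apply: opnorm_leP => // v.
by rewrite mul0mx cvnorm0 mul0r.
Qed.

Lemma opnormD A B : opnorm (A + B) <= opnorm A + opnorm B.
Proof.
apply: opnorm_leP => [|v]; first by rewrite addr_ge0 ?opnorm_ge0.
by rewrite mulmxDl mulrDl (le_trans (cvnormD _ _))// lerD ?cvnorm_mulmx.
Qed.

Lemma opnormBC A B : opnorm (A - B) = opnorm (B - A).
Proof. by rewrite -opnormN opprB. Qed.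

Lemma opnormB A B : opnorm (A - B) <= opnorm A + opnorm B.
Proof. by have := opnormD A (- B); rewrite opnormN. Qed.

Lemma opnorm_triangle B A C : opnorm (A - C) <= opnorm (A - B) + opnorm (B - C).
Proof. by rewrite -[A - C](subrKA B) opnormD. Qed.

Lemma opnorm_dist A B : `|opnorm A - opnorm B| <= opnorm (A - B).
Proof.
have h1 := opnormD (A - B) B; have h2 := opnormD (B - A) A.
rewrite !subrK in h1 h2; rewrite (opnormBC B A) in h2.
move: (opnorm A) (opnorm B) (opnorm (A - B)) h1 h2 => a b c h1 h2.
by rewrite ler_norml; apply/andP; split; lra.
Qed.

Lemma opnormM A B : opnorm (A *m B) <= opnorm A * opnorm B.
Proof.
apply: opnorm_leP => [|v]; first by rewrite mulr_ge0 ?opnorm_ge0.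
rewrite -mulmxA -mulrA (le_trans (cvnorm_mulmx _ _))//.
by rewrite ler_wpM2l ?opnorm_ge0 ?cvnorm_mulmx.
Qed.

Lemma opnormZ (a : R) A : opnorm (a%:C *: A) <= `|a| * opnorm A.
Proof.
apply: opnorm_leP => [|v]; first by rewrite mulr_ge0 ?opnorm_ge0.
rewrite -scalemxAl cvnormZ /= expr0n addr0 sqrtr_sqr -mulrA.
by rewrite ler_wpM2l ?cvnorm_mulmx.
Qed.

Lemma opnorm1 : (0 < n)%N -> opnorm (1%:M : 'M[R[i]]_n) = 1.
Proof.
move=> n0; apply/eqP; rewrite eq_le; apply/andP; split.
  by apply: opnorm_leP => // v; rewrite mul1mx mul1r.
have := normc_le_opnorm 1%:M (Ordinal n0) (Ordinal n0).
by rewrite mxE eqxx ComplexField.Normc.normc1.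
Qed.

End OperatorNorm.

(** * Projections and spectral rounding *)

Section SpectralRounding.
Context {R : realType} {n : nat}.
Implicit Types (A B P Q : 'M[R[i]]_n) (v : 'cV[R[i]]_n).

Lemma trmxC_mul m p q (A : 'M[R[i]]_(m, p)) (B : 'M[R[i]]_(p, q)) :
  (A *m B)^t* = B^t* *m A^t*.
Proof. by rewrite trmx_mul map_mxM. Qed.

Definition orthoproj P := P *m P = P /\ selfadjoint P.

Lemma orthoprojC P : orthoproj P -> orthoproj (1%:M - P).
Proof.
move=> [PP Ps]; split.
  rewrite mulmxBl mul1mx [P *m _]mulmxBr mulmx1 PP subrr subr0; reflexivity.
by rewrite /selfadjoint linearB /= map_mxB trmx1 map_mx1 Ps.
Qed.

(** The cross terms vanish because [P v] and [v - P v] are orthogonal. *)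
Lemma cvnorm_orthoproj P v : orthoproj P ->
  cvnorm v ^+ 2 = cvnorm (P *m v) ^+ 2 + cvnorm (v - P *m v) ^+ 2.
Proof.
move=> hP.
have key Q : orthoproj Q -> ((cvnorm (Q *m v)) ^+ 2)%:C = (v^t* *m Q *m v) 0 0.
  move=> [QQ Qs]; rewrite cvnorm_sqrC trmxC_mul.
  congr (fun_of_matrix _ 0 0).
  rewrite Qs mulmxA -[in LHS](mulmxA (v^t*)) QQ; reflexivity.
have -> : v - P *m v = (1%:M - P) *m v by rewrite mulmxBl mul1mx.
apply: complexI; rewrite rmorphD/= (key _ hP) (key _ (orthoprojC hP)) cvnorm_sqrC.
by rewrite mulmxBr mulmx1 mulmxBl [X in _ = _ + X]mxE [X in _ = _ + (_ + X)]mxE addrC subrK.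
Qed.

Lemma cvnorm_orthoproj_le P v : orthoproj P -> cvnorm (P *m v) <= cvnorm v.
Proof.
move=> hP; apply: cvnorm_le_of_sqr; first exact: cvnorm_ge0.
by rewrite (cvnorm_orthoproj v hP) lerDl sqr_ge0.
Qed.

Lemma opnorm_orthoproj P : orthoproj P -> opnorm P <= 1.
Proof.
by move=> hP; apply: opnorm_leP => // v; rewrite mul1r cvnorm_orthoproj_le.
Qed.

Lemma cvnorm_unitary A v : A^t* *m A = 1%:M -> cvnorm (A *m v) = cvnorm v.
Proof.
move=> h; apply/eqP; rewrite -(@eqrXn2 _ 2) ?cvnorm_ge0//; apply/eqP.
apply: complexI; rewrite !cvnorm_sqrC trmxC_mul.
by rewrite mulmxA -(mulmxA (v^t*)) h mulmx1.
Qed.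

(** On a unit eigenvector [v] the vector [(A - P) v] is the orthogonal sum of
    [(a - 1) P v] and [a (v - P v)], so that its norm is at least the smaller of
    [|a|] and [|1 - a|]. *)
Lemma eigenvalue_near01 A P v (a : R[i]) (d : R) : orthoproj P -> 0 <= d ->
  opnorm (A - P) <= d -> A *m v = a *: v -> cvnorm v = 1 ->
  normc a <= d \/ normc (1 - a) <= d.
Proof.
move=> hP d0 APd Av v1.
have [|ad] := leP (normc a) d; first by left.
have [|bd] := leP (normc (1 - a)) d; first by right.
exfalso.
have hw : cvnorm ((A - P) *m v) <= d.
  by rewrite (le_trans (cvnorm_mulmx _ _))// v1 mulr1.
have Pw : P *m ((A - P) *m v) = (a - 1) *: (P *m v).
  rewrite mulmxBl Av mulmxBr -scalemxAr mulmxA hP.1 scalerBl scale1r; reflexivity.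
have Pcw : (A - P) *m v - P *m ((A - P) *m v) = a *: (v - P *m v).
  rewrite Pw mulmxBl Av scalerBl scalerBr scale1r opprB addrA subrK; reflexivity.
have := cvnorm_orthoproj ((A - P) *m v) hP; rewrite Pcw Pw !cvnormZ.
rewrite -(opprB 1 a) normcN.
have := cvnorm_orthoproj v hP; rewrite v1.
move: hw (cvnorm_ge0 ((A - P) *m v)); move: (cvnorm ((A - P) *m v)) => w.
move: (cvnorm (P *m v)) (cvnorm (v - P *m v)) => x y wd w0 xy wE.
have h1 : d ^+ 2 < normc a ^+ 2 by rewrite ltr_pXn2r// nnegrE ?normc_ge0.
have h2 : d ^+ 2 < normc (1 - a) ^+ 2 by rewrite ltr_pXn2r// nnegrE ?normc_ge0.
have h3 : w ^+ 2 <= d ^+ 2 by rewrite ler_pXn2r// nnegrE.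
move: h1 h2 wE; rewrite !exprMn; move: (normc a ^+ 2) (normc (1 - a) ^+ 2) h3 xy.
move: (d ^+ 2) (w ^+ 2) (sqr_ge0 x) (sqr_ge0 y) => d2 w2.
rewrite expr1n; move: (x ^+ 2) (y ^+ 2) => x2 y2 x0 y0 p q wd2 xy pd qd wE.
have {}wE : w2 = q * (1 - y2) + p * y2 by rewrite wE; congr (q * _ + _); lra.
have [pq|/ltW qp] := leP p q.
  have h : 0 <= (q - p) * (1 - y2) by rewrite mulr_ge0 ?subr_ge0//; lra.
  lra.
have h : 0 <= (p - q) * y2 by rewrite mulr_ge0 ?subr_ge0.
lra.
Qed.

(** Diagonalise [A] and replace each eigenvalue by 0 or 1, whichever is within
    [d] of it. *)
Lemma spectral_rounding A P (d : R) : selfadjoint A -> orthoproj P -> 0 <= d ->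
  opnorm (A - P) <= d ->
  exists Q, [/\ orthoproj Q, A *m Q = Q *m A & opnorm (A - Q) <= d].
Proof.
move=> As hP d0 APd.
have An : A \is normalmx by apply/normalmxP; rewrite As.
have := orthomx_spectralP An; set U := spectralmx A; set D := spectral_diag A.
have Uu : U \is unitarymx by exact: spectral_unitarymx.
rewrite (invmx_unitary Uu) => AE.
have UUs : U *m U^t* = 1%:M by apply/unitarymxP.
have UsU : U^t* *m U = 1%:M by apply: mulmx1C.
pose chi : 'rV[R[i]]_n := \row_i (if normc (1 - D 0 i) <= d then 1 else 0).
have Dchi i : normc (D 0 i - chi 0 i) <= d.
  rewrite mxE; case: ifPn => [h|/negP h]; first by rewrite -opprB normcN.
  pose v : 'cV[R[i]]_n := U^t* *m delta_mx i 0.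
  have v1 : cvnorm v = 1.
    rewrite cvnorm_unitary; last by rewrite trmxCK.
    apply/eqP; rewrite -(@eqrXn2 _ 2) ?cvnorm_ge0// cvnorm_sqr (bigD1 i)//=.
    rewrite big1 ?addr0 => [|k ki].
      by rewrite mxE !eqxx ComplexField.Normc.normc1.
    by rewrite mxE (negbTE ki) ComplexField.Normc.normc0 expr0n.
  have Av : A *m v = D 0 i *: v.
    rewrite AE /v -!mulmxA (mulmxA U) UUs mul1mx scalemxAr; congr (_ *m _).
    rewrite mul_diag_mx; apply/matrixP => j k; rewrite !mxE.
    by case: eqP => [->|] //=; rewrite !mulr0.
  by have [|//] := eigenvalue_near01 hP d0 APd Av v1; rewrite subr0.
have chi2 : diag_mx chi *m diag_mx chi = diag_mx chi.
  rewrite mulmx_diag; congr diag_mx; apply/rowP => i; rewrite !mxE.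
  by case: ifP; rewrite ?mulr1 ?mulr0.
pose Q := U^t* *m diag_mx chi *m U.
exists Q; split.
- split.
    have -> : Q *m Q = U^t* *m (diag_mx chi *m (U *m U^t*) *m diag_mx chi) *m U.
      rewrite /Q !mulmxA; reflexivity.
    rewrite UUs mulmx1 chi2; reflexivity.
  rewrite /selfadjoint /Q !trmxC_mul trmxCK mulmxA tr_diag_mx map_diag_mx.
  congr (_ *m diag_mx _ *m _); apply/rowP => i; rewrite !mxE.
  by case: ifP; rewrite ?rmorph1 ?rmorph0.
- have AQ a b : U^t* *m diag_mx a *m U *m (U^t* *m diag_mx b *m U) =
      U^t* *m (diag_mx a *m (U *m U^t*) *m diag_mx b) *m U.
    rewrite !mulmxA; reflexivity.
  rewrite /Q AE !AQ UUs !mulmx1 diag_mxC; reflexivity.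
- apply: opnorm_leP => // v.
  have -> : (A - Q) *m v = U^t* *m (diag_mx (D - chi) *m (U *m v)).
    by rewrite linearB /= {1}AE /Q -mulmxBl -mulmxBr -!mulmxA.
  rewrite cvnorm_unitary; last by rewrite trmxCK.
  rewrite -(cvnorm_unitary v UsU); apply: cvnorm_le_of_sqr.
    by rewrite mulr_ge0 ?cvnorm_ge0.
  rewrite exprMn !cvnorm_sqr mulr_sumr; apply: ler_sum => i _.
  rewrite mul_diag_mx mxE ComplexField.Normc.normcM exprMn.
  rewrite ler_wpM2r ?sqr_ge0// ler_pXn2r// ?nnegrE ?normc_ge0//.
  by have := Dchi i; rewrite !mxE.
Qed.

(** For [d < 1/2] this says that [P] is the spectral projection of [A] for the
    eigenvalues near 1; it is phrased without eigenvalues because commutation and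
    the norm bound are all that the Lipschitz estimate needs. *)
Definition near_proj (d : R) A P :=
  [/\ orthoproj P, A *m P = P *m A & opnorm (A - P) <= d].

(** Half of the estimate: [X = P (1 - Q)] satisfies
    [P (A - B) (1 - Q) = A X - X B = X + (A - P) X - X (B - Q)], because [A]
    commutes with [P], [B] commutes with [Q], [P X = X] and [X Q = 0]. *)
Lemma near_proj_cross (d : R) A B P Q : 0 <= d -> near_proj d A P -> near_proj d B Q ->
  opnorm (P *m (1%:M - Q)) * (1 - 2 * d) <= opnorm (A - B).
Proof.
move=> d0 [hP AP APd] [hQ BQ BQd].
set X := P *m (1%:M - Q).
have XQ : X *m Q = 0.
  by rewrite /X -mulmxA mulmxBl mul1mx hQ.1 subrr mulmx0.
have PX : P *m X = X by rewrite /X mulmxA hP.1.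
have XE : X = P *m (A - B) *m (1%:M - Q) - (A - P) *m X + X *m (B - Q).
  have -> : P *m (A - B) *m (1%:M - Q) = A *m X - X *m B.
    have BQc : B *m (1%:M - Q) = (1%:M - Q) *m B.
      rewrite mulmxBr mulmxBl mulmx1 mul1mx BQ; reflexivity.
    rewrite (mulmxBr P) mulmxBl -AP -(mulmxA P B) BQc /X !mulmxA; reflexivity.
  by rewrite mulmxBl mulmxBr PX XQ subr0 opprB addrAC subrK addrC subrK.
have h1 : opnorm (P *m (A - B) *m (1%:M - Q)) <= opnorm (A - B).
  apply: le_trans (opnormM _ _) _.
  have h := opnormM P (A - B).
  have hp := opnorm_orthoproj hP; have hq := opnorm_orthoproj (orthoprojC hQ).
  have := opnorm_ge0 (A - B); have := opnorm_ge0 P; have := opnorm_ge0 (1%:M - Q).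
  move: (opnorm (1%:M - Q)) hq h (opnorm_ge0 (P *m (A - B))).
  move: (opnorm (P *m (A - B))) (opnorm P) hp (opnorm (A - B)).
  move=> a b b1 c e e1 acb a0 e0 b0 c0.
  by rewrite (le_trans (ler_piMr a0 e1))// (le_trans acb)// ler_piMl.
have h2 : opnorm ((A - P) *m X) <= d * opnorm X.
  exact: le_trans (opnormM _ _) (ler_wpM2r (opnorm_ge0 X) APd).
have h3 : opnorm (X *m (B - Q)) <= opnorm X * d.
  exact: le_trans (opnormM _ _) (ler_wpM2l (opnorm_ge0 X) BQd).
have h4 := opnormD (P *m (A - B) *m (1%:M - Q) - (A - P) *m X) (X *m (B - Q)).
have h5 := opnormB (P *m (A - B) *m (1%:M - Q)) ((A - P) *m X).
rewrite -XE in h4.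
have arith (x m a b c e : R) : a <= m -> b <= d * x -> c <= x * d ->
  x <= e + c -> e <= a + b -> x * (1 - 2 * d) <= m.
  by clear; move=> *; lra.
exact: arith h1 h2 h3 h4 h5.
Qed.

(** [P - Q = P (1 - Q) - (1 - P) Q]. The two terms have orthogonal ranges and
    factor through the orthogonal projections [1 - Q] and [Q], so the norm of the
    difference is the larger of their norms. The second one is the first for the
    complementary pairs [1 - A, 1 - P] and [1 - B, 1 - Q]. *)
Lemma near_proj_lip (d : R) A B P Q : 0 <= d -> near_proj d A P -> near_proj d B Q ->
  2 * d < 1 -> opnorm (P - Q) <= opnorm (A - B) / (1 - 2 * d).
Proof.
move=> d0 AP BQ d1; have d2 : 0 < 1 - 2 * d by rewrite subr_gt0.
have h1 := near_proj_cross d0 AP BQ.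
have compl C S : near_proj d C S -> near_proj d (1%:M - C) (1%:M - S).
  move=> [hS CS CSd]; split; first exact: orthoprojC.
    have E M N : (1%:M - M) *m (1%:M - N) = 1%:M - N - M + M *m N :> 'M[R[i]]_n.
      by rewrite mulmxBl mul1mx mulmxBr mulmx1 opprB addrA addrAC.
    rewrite !E CS [1%:M - S - C]addrAC; reflexivity.
  have -> : 1%:M - C - (1%:M - S) = S - C by rewrite opprB addrC addrA subrK.
  by rewrite opnormBC.
have := near_proj_cross d0 (compl _ _ AP) (compl _ _ BQ).
have -> : 1%:M - A - (1%:M - B) = B - A by rewrite opprB addrC addrA subrK.
rewrite (opnormBC B A) subKr => h2.
case: AP BQ => [hP _ _] [hQ _ _].
set m := opnorm (A - B) / (1 - 2 * d).
have hm1 : opnorm (P *m (1%:M - Q)) <= m.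
  rewrite /m ler_pdivlMr; [exact: h1|exact: d2].
have hm2 : opnorm ((1%:M - P) *m Q) <= m.
  rewrite /m ler_pdivlMr; [exact: h2|exact: d2].
have m0 : 0 <= m by apply: le_trans (opnorm_ge0 _) hm1.
apply: opnorm_leP => // v.
have Pe : P *m ((P - Q) *m v) = P *m (1%:M - Q) *m ((1%:M - Q) *m v).
  have Qc := (orthoprojC hQ).1.
  rewrite !mulmxA -(mulmxA P (1%:M - Q)) Qc mulmxBr hP.1 mulmxBr mulmx1; reflexivity.
have Pce : (P - Q) *m v - P *m ((P - Q) *m v) = - ((1%:M - P) *m Q *m (Q *m v)).
  have PQE : P - Q - P *m (P - Q) = - ((1%:M - P) *m Q).
    by rewrite mulmxBr hP.1 mulmxBl mul1mx !opprB addrC addrA subrK.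
  rewrite [in RHS]mulmxA -(mulmxA _ Q Q) hQ.1 -[in RHS]mulNmx -PQE [in RHS]mulmxBl -mulmxA.
  reflexivity.
apply: cvnorm_le_of_sqr; first by rewrite mulr_ge0 ?cvnorm_ge0.
rewrite (cvnorm_orthoproj _ hP) Pce cvnormN Pe.
rewrite exprMn (cvnorm_orthoproj v (orthoprojC hQ)) mulrDr.
have -> : v - (1%:M - Q) *m v = Q *m v by rewrite mulmxBl mul1mx subKr.
have sq (C : 'M[R[i]]_n) w : opnorm C <= m -> cvnorm (C *m w) ^+ 2 <= m ^+ 2 * cvnorm w ^+ 2.
  move=> Cm; rewrite -exprMn; apply: lerXn2r; rewrite ?nnegrE.
  - exact: cvnorm_ge0.
  - exact: mulr_ge0 m0 (cvnorm_ge0 w).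
  - exact: le_trans (cvnorm_mulmx _ _) (ler_wpM2r (cvnorm_ge0 w) Cm).
exact: lerD (sq _ _ hm1) (sq _ _ hm2).
Qed.
End SpectralRounding.

(** * Lipschitz functions, prescribed metrics and the unit interval *)

Section MetricLemmas.
Context {R : realType}.

Lemma is_metric_ge0 (W : Type) (d : W -> W -> R) : is_metric d ->
  forall x y, 0 <= d x y.
Proof.
move=> [d0 _ dC dT] x y; have := dT x y x; rewrite d0 (dC y x); lra.
Qed.

Lemma is_metric_gt0 (W : Type) (d : W -> W -> R) : is_metric d ->
  forall x y, x <> y -> 0 < d x y.
Proof.
move=> dm x y xy; rewrite lt_neqAle is_metric_ge0// andbT eq_sym.
by apply/eqP; have [_ d0 _ _] := dm; move/d0.
Qed.

Lemma mdist_is_metric (W : metricType R) : is_metric (@mdist R W).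
Proof.
split; [exact: mdistxx|exact: mdist_positivity|exact: metric_sym|].
exact: metric_triangle.
Qed.

Context {n : nat}.

Definition lipschitz_le (W : Type) (d : W -> W -> R) (D : set W) (N : R)
    (a : W -> 'M[R[i]]_n) :=
  forall x y, D x -> D y -> opnorm (a x - a y) <= N * d x y.

Lemma lip_leP (W : Type) (d : W -> W -> R) (D : set W) (a : W -> 'M[R[i]]_n) N :
  is_metric d -> (lip d D a <= N%:E)%E <-> 0 <= N /\ lipschitz_le d D N a.
Proof.
move=> dm; split=> [h|[N0 aN]].
  have N0 : 0 <= N.
    by rewrite -lee_fin (le_trans _ h)//; apply: ereal_sup_ubound; left.
  split=> // x y Dx Dy; have [->|xy] := pselect (x = y).
    by rewrite subrr opnorm0 mulr_ge0// is_metric_ge0.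
  rewrite -ler_pdivrMr ?is_metric_gt0//.
  rewrite -lee_fin (le_trans _ h)//; apply: ereal_sup_ubound; right.
  by exists (x, y).
apply: ge_ereal_sup => _ [->|[[x y] /= [Dx Dy xy] <-]]; rewrite lee_fin//.
by rewrite ler_pdivrMr ?is_metric_gt0//; exact: aN.
Qed.

Lemma lip_ltP (W : Type) (d : W -> W -> R) (D : set W) (a : W -> 'M[R[i]]_n) K :
  is_metric d -> (lip d D a < K%:E)%E <->
  exists2 N, 0 <= N < K & lipschitz_le d D N a.
Proof.
move=> dm; split=> [h|[N /andP[N0 NK] aN]]; last first.
  by rewrite (@le_lt_trans _ _ N%:E)// lip_leP.
have l0 : (0 <= lip d D a)%E by apply: ereal_sup_ubound; left.
have lf : lip d D a \is a fin_num by rewrite ge0_fin_numE// (lt_trans h)// ltry.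
have /(lip_leP _ _ _ dm) [N0 aN] : (lip d D a <= (fine (lip d D a))%:E)%E.
  by rewrite fineK.
by exists (fine (lip d D a)) => //; rewrite N0 -lte_fin fineK.
Qed.

Lemma supnorm_le (W : Type) (D : set W) (a : W -> 'M[R[i]]_n) (c : R) : 0 <= c ->
  (forall w, D w -> opnorm (a w) <= c) -> (supnorm D a <= c%:E)%E.
Proof.
by move=> c0 h; apply: ge_ereal_sup => _ [->|[w Dw <-]]; rewrite lee_fin// h.
Qed.

Lemma supnorm_ub (W : Type) (D : set W) (a : W -> 'M[R[i]]_n) w : D w ->
  ((opnorm (a w))%:E <= supnorm D a)%E.
Proof. by move=> Dw; apply: ereal_sup_ubound; right; exists w. Qed.

Lemma supnorm_lt (W : Type) (D : set W) (a : W -> 'M[R[i]]_n) (c : R) w :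
  (supnorm D a < c%:E)%E -> D w -> opnorm (a w) < c.
Proof. by move=> h Dw; rewrite -lte_fin (le_lt_trans _ h)// supnorm_ub. Qed.

Lemma lipschitz_continuous (W : metricType R) (N : R) (a : W -> 'M[R[i]]_n) :
  lipschitz_le mdist setT N a -> mx_continuous_on setT a.
Proof.
move=> aN x _ e e0.
have N0 : 0 < `|N| + 1 by rewrite ltr_wpDl.
near=> y.
rewrite opnormBC (le_lt_trans (aN _ _ I I))//.
rewrite (@le_lt_trans _ _ ((`|N| + 1) * mdist x y))//.
  by rewrite ler_wpM2r ?mdist_ge0// (le_trans (ler_norm _))// lerDl.
rewrite mulrC -ltr_pdivlMr//.
near: y; apply: cvg_within; apply/nbhs_ballP; exists (e / (`|N| + 1)) => /=.
  by rewrite divr_gt0.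
by move=> y; rewrite ballEmdist.
Unshelve. all: by end_near. Qed.

End MetricLemmas.

(** A space carrying a prescribed metric, so that statements about metric types
    apply to it. *)
Definition metrized (R : realType) (W : choiceType) (d : W -> W -> R)
  (dm : is_metric d) : Type := W.

Section Metrized.
Context {R : realType} (W : choiceType) (d : W -> W -> R) (dm : is_metric d).

HB.instance Definition _ := Choice.on (metrized dm).

Let d0 : forall x, d x x = 0. Proof. by case: dm. Qed.
Let dpos : forall x y, d x y = 0 -> x = y. Proof. by case: dm. Qed.
Let dC : forall x y, d x y = d y x. Proof. by case: dm. Qed.
Let dT : forall y x z, d x z <= d x y + d y z.
Proof. by case: dm => _ _ _ h y x z. Qed.

HB.instance Definition _ := isMetric.Build R (metrized dm) d0 dpos dC dT.

Lemma mdist_metrized : @mdist R (metrized dm) = d.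
Proof. by []. Qed.

Lemma isometry_continuous (V : metricType R) (f : V -> metrized dm) :
  (forall x y, d (f x) (f y) = mdist x y) -> continuous f.
Proof.
move=> fE x; apply/cvg_ballP => e e0; near=> y.
rewrite ballEmdist /= [X in X < _](fE x y); near: y; apply/nbhs_ballP; exists e => //= y.
by rewrite ballEmdist.
Unshelve. all: by end_near. Qed.

End Metrized.

Section UnitInterval.
Context {R : realType}.

(** The unit interval as a compact space of parameters. Paths are functions on
    the line that are constrained on the interval only; [clamp] goes from one
    point of view to the other. *)
Definition uitv : set R := [set` `[(0 : R), 1]].

Lemma uitv_clamp (t : R) : Num.max 0 (Num.min 1 t) \in uitv.
Proof.
rewrite inE /uitv /= in_itv/=; apply/andP; split; first by rewrite le_max lexx.
by rewrite ge_max ler01 ge_min lexx.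
Qed.

Definition clamp (t : R) : uitv := SigSub (uitv_clamp t).

Lemma clamp_id (t : R) : t \in `[0, 1] -> set_val (clamp t) = t.
Proof.
rewrite in_itv/= => /andP[t0 t1]; rewrite set_valE /=.
by rewrite (min_idPr t1) (max_idPr t0).
Qed.

Lemma clampK (t : uitv) : clamp (set_val t) = t.
Proof.
by by apply: val_inj; have := @clamp_id (set_val t) (set_valP t).
Qed.

Lemma clamp_continuous : continuous clamp.
Proof.
apply: continuous_comp_initial => t.
have : {for t, continuous ((cst 0 : R -> R^o) \max ((cst 1 : R -> R^o) \min id))}.
  apply: continuous_max; first exact: cst_continuous.
  by apply: continuous_min; [exact: cst_continuous|exact: cvg_id].
by rewrite set_valE.
Qed.

Lemma nbhs_clamp (t : R) (A : set uitv) : nbhs (clamp t) A ->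
  exists2 d : R, 0 < d & forall u, `|u - t| < d -> A (clamp u).
Proof.
move=> /(@clamp_continuous t)/nbhs_ballP [d /= d0 dA]; exists d => // u ut.
by apply: (dA u); rewrite /ball /= distrC.
Qed.

Lemma compact_uitv : compact [set: uitv].
Proof.
have -> : [set: uitv] = clamp @` uitv.
  by apply/seteqP; split=> // t _; exists (set_val t);
    [exact: set_valP|rewrite clampK].
apply: continuous_compact; last exact: segment_compact.
exact/continuous_subspaceT/clamp_continuous.
Qed.

End UnitInterval.

Section UniformContinuity.
Context {R : realType} {n : nat}.

(** Finitely many product neighbourhoods cover [K x {t}], so that one
    neighbourhood of [t] serves all the points of [K]. *)
Lemma near_uniform (Z T : topologicalType) (K : set Z) (F : Z * T -> 'M[R[i]]_n)
    (t : T) (e : R) : compact K -> mx_continuous_on (K `*` setT) F -> 0 < e ->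
  \forall u \near t, forall z, K z -> opnorm (F (z, u) - F (z, t)) <= e.
Proof.
move=> /compact_near_coveringP/near_covering_withinP cK cF e0.
have e20 : 0 < e / 2 by rewrite divr_gt0.
have := cK T (nbhs t) (fun u z => opnorm (F (z, u) - F (z, t)) <= e) _.
apply => z Kz; have := cF (z, t) (conj Kz I) _ e20.
move=> [[A B] [/= Az Bt] AB]; exists (A, B) => // -[y u] [/= Ay Bu] Ky.
have h1 := AB (y, u) (conj Ay Bu) (conj Ky I).
have h2 := AB (y, t) (conj Ay (nbhs_singleton Bt)) (conj Ky I).
rewrite (splitr e); apply: le_trans (opnorm_triangle (F (z, t)) _ _) _.
apply: lerD; first exact: ltW h1.
rewrite opnormBC; exact: ltW h2.
Qed.

End UniformContinuity.

(** * McShane extension and retraction onto a ball *)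

Section McShane.
Context {R : realType} {Z : metricType R}.
Implicit Types (X : set Z) (f g : Z -> R).

Definition mcshane X (N : R) f (z : Z) : R :=
  inf [set f x + N * mdist x z | x in X].

Definition real_lipschitz X (N : R) f :=
  forall x y, X x -> X y -> f x - f y <= N * mdist x y.

Lemma mcshane_lbound X N f x0 z : 0 <= N -> X x0 -> real_lipschitz X N f ->
  lbound [set f x + N * mdist x z | x in X] (f x0 - N * mdist x0 z).
Proof.
move=> N0 Xx0 fN _ [x Xx <-]; have h1 := fN _ _ Xx0 Xx.
have h2 : N * mdist x0 x <= N * mdist x0 z + N * mdist x z.
  rewrite -mulrDr ler_wpM2l// (le_trans (metric_triangle _ z _))//.
  by rewrite (metric_sym z x).
lra.
Qed.

Lemma mcshane_extends X N f z : 0 <= N -> X z -> real_lipschitz X N f ->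
  mcshane X N f z = f z.
Proof.
move=> N0 Xz fN; have lb := mcshane_lbound (z := z) N0 Xz fN.
rewrite mdistxx mulr0 subr0 in lb.
apply/eqP; rewrite eq_le; apply/andP; split.
  by apply: ge_inf; [exists (f z)|exists z => //; rewrite mdistxx mulr0 addr0].
by apply: lb_le_inf => //; exists (f z + N * mdist z z), z.
Qed.

(** The same inequality gives the Lipschitz bound in [z] (for [f = g]) and the
    continuity with respect to [f]. *)
Lemma mcshane_compare X N f g e z z' : 0 <= N -> X !=set0 ->
  real_lipschitz X N f -> (forall x, X x -> f x - g x <= e) ->
  mcshane X N f z - mcshane X N g z' <= e + N * mdist z z'.
Proof.
move=> N0 [x0 Xx0] fN fg.
suff : mcshane X N f z - (e + N * mdist z z') <= mcshane X N g z' by lra.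
apply: lb_le_inf; first by exists (g x0 + N * mdist x0 z'), x0.
move=> _ [x Xx <-]; have h1 := fg x Xx.
have h2 : N * mdist x z <= N * mdist x z' + N * mdist z z'.
  rewrite -mulrDr ler_wpM2l// (le_trans (metric_triangle _ z' _))//.
  by rewrite (metric_sym z' z).
have h3 : mcshane X N f z <= f x + N * mdist x z.
  apply: ge_inf; last by exists x.
  by exists (f x0 - N * mdist x0 z); exact: mcshane_lbound.
lra.
Qed.

End McShane.

Section Hermitize.
Context {R : realType} {n : nat}.
Implicit Types (A B : 'M[R[i]]_n).

Lemma opnorm_entries_le A (k : R) : (forall i j, normc (A i j) <= k) ->
  opnorm A <= (n * n)%:R * k.
Proof.
move=> Ak; apply: le_trans (opnorm_le_entry A) _.
have -> : (n * n)%:R * k = \sum_(i < n) \sum_(j < n) k.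
  by rewrite !sumr_const card_ord -mulrnA mulr_natl.
by apply: ler_sum => i _; apply: ler_sum => j _.
Qed.

Lemma Re_le_normc (a : R[i]) : complex.Re a <= normc a.
Proof.
case: a => x y /=; rewrite (le_trans (ler_norm x))// -sqrtr_sqr ler_wsqrtr//.
by rewrite lerDl sqr_ge0.
Qed.

Lemma Im_le_normc (a : R[i]) : complex.Im a <= normc a.
Proof.
case: a => x y /=; rewrite (le_trans (ler_norm y))// -sqrtr_sqr ler_wsqrtr//.
by rewrite lerDr sqr_ge0.
Qed.

Lemma normc_le_ReIm (x y : R) : normc (x +i* y) <= `|x| + `|y|.
Proof.
rewrite /= -[leRHS]ger0_norm ?addr_ge0// -sqrtr_sqr ler_wsqrtr//.
rewrite sqrrD !real_normK ?num_real// [leRHS]addrAC lerDl.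
by rewrite mulrn_wge0 ?mulr_ge0.
Qed.

Lemma selfadjoint_scale (a : R) A : selfadjoint A -> selfadjoint (a%:C *: A).
Proof.
rewrite /selfadjoint => As; apply/matrixP => i j; rewrite !mxE rmorphM /=.
have /matrixP/(_ i j) := As; rewrite !mxE => ->; congr (_ * _).
exact: conjc_real.
Qed.

Definition hermitize A := (2^-1 : R)%:C *: (A + A^t*).

Lemma hermitize_selfadjoint A : selfadjoint (hermitize A).
Proof.
apply: selfadjoint_scale.
by rewrite /selfadjoint linearD /= map_mxD trmxCK addrC.
Qed.

Lemma hermitize_id A : selfadjoint A -> hermitize A = A.
Proof.
move=> As; rewrite /hermitize As -mulr2n -[A *+ 2](@scaler_nat R[i] _ 2 A) scalerA.
have -> : (2^-1 : R)%:C * 2%:R = 1; last by rewrite scale1r.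
by rewrite -(rmorph_nat (real_complex R)) -rmorphM mulVf// rmorph1.
Qed.

Lemma normc_hermitize A (k : R) : (forall i j, normc (A i j) <= k) ->
  forall i j, normc (hermitize A i j) <= k.
Proof.
move=> Ak i j; rewrite !mxE ComplexField.Normc.normcM.
have -> : normc ((2^-1 : R)%:C) = 2^-1.
  by rewrite /= expr0n addr0 sqrtr_sqr ger0_norm.
have h1 := le_normcD (A i j) ((A j i)^*)%C; have h2 := Ak i j.
have h3 : normc ((A j i)^*)%C <= k.
  by have := Ak j i; case: (A j i) => x y /=; rewrite sqrrN.
rewrite mulrC ler_pdivrMr// (le_trans h1)// mulrC mulr_natl mulr2n.
exact: lerD.
Qed.

Lemma hermitizeB A B : hermitize A - hermitize B = hermitize (A - B).
Proof.
rewrite /hermitize -scalerBr.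
have -> : (A - B)^t* = A^t* - B^t* by rewrite linearB /= map_mxB.
by rewrite opprD addrACA.
Qed.

End Hermitize.

Section Retraction.
Context {R : realType} {n : nat}.
Implicit Types (A B : 'M[R[i]]_n).

Definition ball_retract (M : R) A := (M / Num.max M (opnorm A))%:C *: A.

Lemma ball_retract_id M A : opnorm A <= M -> ball_retract M A = A.
Proof.
move=> AM; rewrite /ball_retract (max_idPl AM).
have [M0|M0] := ltP 0 M; first by rewrite divff ?gt_eqF// scale1r.
have -> : A = 0; last by rewrite scaler0.
exact/opnorm_eq0/(le_trans AM).
Qed.

Lemma ball_retract_le M A : 0 <= M -> opnorm (ball_retract M A) <= M.
Proof.
move=> M0; have [AM|/ltW MA] := leP (opnorm A) M.
  rewrite ball_retract_id; exact: AM.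
apply: le_trans (opnormZ _ _) _; rewrite (max_idPr MA).
have A0 := opnorm_ge0 A; rewrite ger0_norm ?divr_ge0//.
have [->|A1] := eqVneq (opnorm A) 0; first by rewrite mulr0.
by rewrite divfK.
Qed.

Lemma radial_factor (M x y c : R) : 0 < M -> 0 <= y -> `|x - y| <= c ->
  `|M / Num.max M x| <= 1 /\
  `|M / Num.max M x - M / Num.max M y| * y <= c.
Proof.
move=> M0 y0 xyc; set a := Num.max M x; set b := Num.max M y.
have Ma : M <= a by rewrite le_max lexx.
have yb : y <= b by rewrite le_max lexx orbT.
have ab : `|b - a| <= c.
  rewrite distrC; apply: le_trans xyc; rewrite /a /b.
  move: (ler_norm (x - y)) (ler_norm (y - x)); rewrite (distrC y x).
  move: (`|x - y|) => z h1 h2; rewrite ler_norml.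
  by case: (leP M x); case: (leP M y) => *; apply/andP; split; lra.
have a0 : 0 < a by apply: lt_le_trans Ma.
have b0 : 0 < b by apply: lt_le_trans M0 _; rewrite le_max lexx.
clearbody a b.
have k1 : `|M / a| <= 1 by rewrite normrM normfV !gtr0_norm// ler_pdivrMr// mul1r.
split=> //.
have -> : M / a - M / b = (M / a) * ((b - a) / b) by field; rewrite !gt_eqF.
rewrite normrM -mulrA (le_trans _ ab)// (le_trans (ler_piMl _ k1))//.
  by rewrite mulr_ge0.
by rewrite normrM normfV (gtr0_norm b0) -mulrA ler_piMr// mulrC ler_pdivrMr// mul1r.
Qed.

(** With [k = M / max M ‖A‖] and [l] its analogue for [B], write
    [k A - l B = k (A - B) + (k - l) B]; both terms are at most [‖A - B‖]. *)
Lemma ball_retract_lip M A B : 0 <= M ->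
  opnorm (ball_retract M A - ball_retract M B) <= 2 * opnorm (A - B).
Proof.
rewrite le_eqVlt => /predU1P[<-|M0].
  have E C : ball_retract 0 C = 0 by rewrite /ball_retract mul0r scale0r.
  rewrite !E subrr opnorm0; exact: mulr_ge0 (ler0n _ 2) (opnorm_ge0 _).
have [h1 h2] := radial_factor M0 (opnorm_ge0 B) (opnorm_dist A B).
have kl (k l : R) : k%:C *: A - l%:C *: B = k%:C *: (A - B) + (k - l)%:C *: B.
  by rewrite (rmorphB (real_complex R)) scalerBr scalerBl addrA subrK.
rewrite /ball_retract kl.
apply: le_trans (opnormD _ _) _; rewrite mulr_natl mulr2n; apply: lerD.
  exact: le_trans (opnormZ _ _) (ler_piMl (opnorm_ge0 _) h1).
exact: le_trans (opnormZ _ _) h2.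
Qed.

(** The radius is extended real, as the supremum norm is. *)
Lemma exists_retraction (S : \bar R) : (0 <= S)%E ->
  exists ret : 'M[R[i]]_n -> 'M[R[i]]_n,
    [/\ forall A, ((opnorm A)%:E <= S)%E -> ret A = A,
        forall A, ((opnorm (ret A))%:E <= S)%E,
        forall A, selfadjoint A -> selfadjoint (ret A) &
        forall A B, opnorm (ret A - ret B) <= 2 * opnorm (A - B)].
Proof.
case: S => [M| |//]; rewrite ?lee_fin => M0; last first.
  exists id; split=> // [A|A B]; first by rewrite leey.
  by rewrite ler_peMl ?opnorm_ge0 ?ler1n.
exists (ball_retract M); split => [A|A|A|A B]; rewrite ?lee_fin.
- exact: ball_retract_id.
- exact: ball_retract_le.
- exact: selfadjoint_scale.
- exact: ball_retract_lip.
Qed.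

End Retraction.

(** * Extension constants *)

Section ExtensionConstant.
Context {R : realType}.

Lemma opnorm_sub_coord n (A B : 'M[R[i]]_n) i j :
  complex.Re (A i j) - complex.Re (B i j) <= opnorm (A - B) /\
  complex.Im (A i j) - complex.Im (B i j) <= opnorm (A - B).
Proof.
have -> : complex.Re (A i j) - complex.Re (B i j) = complex.Re ((A - B) i j).
  by rewrite !mxE; case: (A i j) => ? ?; case: (B i j).
have -> : complex.Im (A i j) - complex.Im (B i j) = complex.Im ((A - B) i j).
  by rewrite !mxE; case: (A i j) => ? ?; case: (B i j).
have h := normc_le_opnorm (A - B) i j.
by split; [exact: le_trans (Re_le_normc _) h|exact: le_trans (Im_le_normc _) h].
Qed.

Section McShaneMatrix.
Context {Z : metricType R} {T : topologicalType} {n : nat}.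
Variables (X : set Z) (N : R) (F : Z * T -> 'M[R[i]]_n).
Hypotheses (X0 : X !=set0) (N0 : 0 <= N).
Hypothesis FN : forall t, lipschitz_le mdist X N (fun x => F (x, t)).

Definition mcshane_mx (zt : Z * T) : 'M[R[i]]_n :=
  \matrix_(i, j) (mcshane X N (fun x => complex.Re (F (x, zt.2) i j)) zt.1 +i*
                  mcshane X N (fun x => complex.Im (F (x, zt.2) i j)) zt.1).

Let ReN t i j : real_lipschitz X N (fun x => complex.Re (F (x, t) i j)).
Proof. move=> x y Xx Xy; exact: le_trans (opnorm_sub_coord _ _ i j).1 (FN t Xx Xy). Qed.

Let ImN t i j : real_lipschitz X N (fun x => complex.Im (F (x, t) i j)).
Proof. move=> x y Xx Xy; exact: le_trans (opnorm_sub_coord _ _ i j).2 (FN t Xx Xy). Qed.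

Lemma mcshane_mx_extends x t : X x -> mcshane_mx (x, t) = F (x, t).
Proof.
move=> Xx; apply/matrixP => i j; rewrite mxE /=.
by rewrite !mcshane_extends//; case: (F (x, t) i j).
Qed.

Lemma mcshane_mx_compare z z' t t' e :
  (forall x, X x -> opnorm (F (x, t) - F (x, t')) <= e) ->
  opnorm (hermitize (mcshane_mx (z, t)) - hermitize (mcshane_mx (z', t'))) <=
    (n * n)%:R * (2 * (e + N * mdist z z')).
Proof.
move=> Fe; rewrite hermitizeB; apply: opnorm_entries_le.
apply: normc_hermitize => i j; rewrite !mxE /=.
have Fe' x : X x -> opnorm (F (x, t') - F (x, t)) <= e.
  by move=> Xx; rewrite opnormBC; exact: Fe.
apply: le_trans (normc_le_ReIm _ _) _; rewrite mulr_natl mulr2n.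
apply: lerD; rewrite ler_norml lerNl opprB; apply/andP; split.
- rewrite metric_sym; apply: mcshane_compare => // x Xx.
  exact: le_trans (opnorm_sub_coord _ _ i j).1 (Fe' x Xx).
- apply: mcshane_compare => // x Xx.
  exact: le_trans (opnorm_sub_coord _ _ i j).1 (Fe x Xx).
- rewrite metric_sym; apply: mcshane_compare => // x Xx.
  exact: le_trans (opnorm_sub_coord _ _ i j).2 (Fe' x Xx).
- apply: mcshane_compare => // x Xx.
  exact: le_trans (opnorm_sub_coord _ _ i j).2 (Fe x Xx).
Qed.

End McShaneMatrix.

(** McShane extension of the real and imaginary parts of the entries, followed
    by the projection to the self-adjoint matrices and by the retraction onto
    the ball of radius [‖F‖]. The factors are [n^2] for the number of entries,
    2 for the two parts and 2 for the retraction. *)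
Lemma extension_constant_exists n : extension_constant n (4 * (n * n)%:R : R).
Proof.
move=> Z X T F N cZ clX cT cF Fsa FN.
have FNt t : 0 <= N /\ lipschitz_le mdist X N (fun x => F (x, t)).
  exact/(lip_leP _ _ _ (@mdist_is_metric _ Z)).
have [X0|/nonemptyPn X0] := pselect (X !=set0); last first.
  exists (fun=> 0); split.
  - by move=> zt _ e e0; near=> w; rewrite subrr opnorm0.
  - by move=> z t; rewrite /selfadjoint linear0 map_mx0.
  - by move=> x t; rewrite X0.
  - move=> t; apply/(lip_leP _ _ _ (@mdist_is_metric _ Z)); have [N0 _] := FNt t.
    have cN : 0 <= 4 * (n * n)%:R * N by rewrite !mulr_ge0.
    by split => // x y _ _; rewrite subrr opnorm0 mulr_ge0 ?mdist_ge0.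
  - rewrite X0 set0X /supnorm image_set0 setU0 ereal_sup1.
    apply/eqP; rewrite eq_le; apply/andP; split.
      by apply: supnorm_le => // w _; rewrite opnorm0.
    by apply: ereal_sup_ubound; left.
have cX : compact X by exact: subclosed_compact cZ _.
(* The retraction restores the supremum norm of [F]. *)
have [ret [retid retle retsa retlip]] := @exists_retraction R n
  (supnorm (X `*` setT) F) (ereal_sup_ubound (or_introl erefl)).
pose G zt := ret (hermitize (mcshane_mx X N F zt)).
have GF x t : X x -> G (x, t) = F (x, t).
  move=> Xx; have [N0 _] := FNt t.
  rewrite /G mcshane_mx_extends//; last by move=> u; exact: (FNt u).2.
  rewrite hermitize_id; last exact: Fsa.
  by apply: retid; exact: supnorm_ub.
have Gcmp z z' t t' e :
    (forall x, X x -> opnorm (F (x, t) - F (x, t')) <= e) ->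
    opnorm (G (z, t) - G (z', t')) <= 4 * (n * n)%:R * (e + N * mdist z z').
  move=> Fe; apply: le_trans (retlip _ _) _.
  have [N0 _] := FNt t.
  have := mcshane_mx_compare X0 N0 (fun u => (FNt u).2) z z' Fe.
  move: (opnorm _) (e + _) => x y xy; clear -xy.
  have -> : 4 * (n * n)%:R * y = 2 * ((n * n)%:R * (2 * y)) by ring.
  by rewrite ler_pM2l.
exists G; split.
- move=> [z t] _ e e0.
  pose k := 4 * (n * n)%:R + 1 : R.
  have k0 : 0 < k by rewrite ltr_wpDl// mulr_ge0.
  have [N0 _] := FNt t.
  have N1 : 0 < N + 1 by rewrite ltr_wpDl.
  have ek0 : 0 < e / (2 * k) by rewrite divr_gt0 ?mulr_gt0.
  have eN0 : 0 < e / (2 * k * (N + 1)) by rewrite divr_gt0 ?mulr_gt0.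
  have nt := near_uniform t cX cF ek0.
  have nz : \forall z' \near z, mdist z z' < e / (2 * k * (N + 1)).
    by apply/nbhs_ballP; exists (e / (2 * k * (N + 1))) => //= z'; rewrite ballEmdist.
  apply: cvg_within.
  exists ([set z' | mdist z z' < e / (2 * k * (N + 1))],
    [set u | forall x, X x -> opnorm (F (x, u) - F (x, t)) <= e / (2 * k)]) => //.
  move=> [z' u] /= [hz hu]; apply: le_lt_trans (Gcmp _ _ _ _ _ hu) _.
  rewrite metric_sym.
  have h1 : N * mdist z z' <= e / (2 * k).
    have -> : e / (2 * k) = (N + 1) * (e / (2 * k * (N + 1))).
      by field; rewrite !gt_eqF.
    apply: ler_pM => //; [exact: mdist_ge0|by rewrite lerDl|exact: ltW].
  have h2 : e / (2 * k) + N * mdist z z' <= e / k.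
    have -> : e / k = e / (2 * k) + e / (2 * k) by field; rewrite gt_eqF.
    by rewrite lerD2l.
  apply: (@le_lt_trans _ _ (4 * (n * n)%:R * (e / k))).
    by rewrite ler_wpM2l// mulr_ge0.
  rewrite mulrC -mulrA gtr_pMr// mulrC ltr_pdivrMr// mul1r.
  by rewrite ltrDl.
- move=> z t; apply: retsa; exact: hermitize_selfadjoint.
- exact: GF.
- move=> t; apply/(lip_leP _ _ _ (@mdist_is_metric _ Z)); have [N0 _] := FNt t.
  split=> [|z z' _ _]; first by rewrite !mulr_ge0.
  have := Gcmp z z' t t 0; rewrite add0r mulrA; apply=> x _.
  by rewrite subrr opnorm0.
- apply/eqP; rewrite eq_le; apply/andP; split.
    apply: ge_ereal_sup => _ [->|[zt _ <-]]; last exact: retle.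
    by apply: ereal_sup_ubound; left.
  apply: le_ereal_sup => _ [->|[[x t] [Xx _] <-]]; [by left|right].
  exists (x, t); first by [].
  rewrite GF; [reflexivity|exact: Xx].
Unshelve. all: by end_near. Qed.

(** Two points at distance 1 with values [0] and [1]: an extension of a
    function defined everywhere is the function itself. *)
Lemma extension_constant_ge1 n (c : R) : (0 < n)%N -> extension_constant n c -> 1 <= c.
Proof.
move=> n0 ext.
pose d (x y : bool) : R := (x != y)%:R.
have dm : is_metric d.
  split=> [x|x y|x y|x y z]; rewrite /d ?eqxx// 1?eq_sym//.
    by case: eqP => // _ /eqP; rewrite oner_eq0.
  by case: x; case: y; case: z => /=; lra.
pose F (zt : metrized dm * bool) : 'M[R[i]]_n := if zt.1 : bool then 1%:M else 0.
have FT x y : opnorm (F (x, true) - F (y, true)) = d x y.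
  case: x; case: y; rewrite /F/= /d/= ?subrr ?opnorm0 ?subr0 ?opnorm1//.
  by rewrite sub0r opnormN opnorm1.
have Flip t : lipschitz_le (@mdist R (metrized dm)) setT 1 (fun x => F (x, t)).
  by move=> x y _ _; rewrite mul1r -[F (x, t)]/(F (x, true)) -[F (y, t)]/(F (y, true)) FT.
have fin_cpt (W : topologicalType) : finite_set [set: W] -> compact [set: W].
  exact: finite_compact.
have [||||||G [_ _ GF Glip _]] := ext (metrized dm) setT bool F 1.
- by apply: fin_cpt; exact: (finite_finset (T := bool)).
- exact: closedT.
- by apply: fin_cpt; exact: (finite_finset (T := bool)).
- move=> [x t] _ e e0; apply: cvg_within.
  exists ([set y | mdist x y < 1], setT); first split; last 1 first.
  - move=> [y u] /= [xy _]; have -> : y = x.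
      by move: xy; rewrite mdist_metrized /d; case: eqP => //; rewrite ltxx.
    by rewrite /F subrr opnorm0.
  - by apply/nbhs_ballP; exists 1 => //= y; rewrite ballEmdist.
  - exact: filterT.
- move=> x t _; rewrite /F /selfadjoint; case: x.
    by rewrite trmx1 map_mx1.
  by rewrite linear0 map_mx0.
- by move=> t; apply/(lip_leP _ _ _ (@mdist_is_metric _ _)).
have /(lip_leP _ _ _ (@mdist_is_metric _ _)) [_ GN] := Glip true.
have := GN true false I I; rewrite !GF// FT mulr1 /d/=.
by rewrite mulr1.
Qed.

(** An empty set of constants would have infimum 0, so both the existence of an
    extension constant and the lower bound 1 are used. *)
Lemma lambda_gt0 n : (0 < n)%N -> 0 < lambda n :> R.
Proof.
move=> n0; apply: lt_le_trans ltr01 _; apply: lb_le_inf.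
  by exists (4 * (n * n)%:R); exact: extension_constant_exists.
by move=> c; exact: extension_constant_ge1.
Qed.

(** An infimum need not be attained: this is how [lambda n] is used as if it
    were an extension constant. *)
Lemma lambda_approx n (c : R) : lambda n < c ->
  exists2 c', extension_constant n c' & c' < c.
Proof.
move=> lc; apply: inf_lt lc.
by exists (4 * (n * n)%:R); exact: extension_constant_exists.
Qed.

End ExtensionConstant.

(** * Paths of projections *)

Section Paths.
Context {R : realType} {W : Type} {n : nat}.
Implicit Types (S : set (W -> 'M[R[i]]_n)) (a b c : W -> 'M[R[i]]_n).

Lemma is_path_in_near (S : set (W -> 'M[R[i]]_n)) a b p (t e : R) :
  is_path_in S a b p -> t \in `[0, 1] -> 0 < e ->
  exists2 d : R, 0 < d & forall u, u \in `[0, 1] -> `|u - t| < d ->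
    (supnorm setT (p u \- p t)%R < e%:E)%E.
Proof.
move=> [_ _ _ pc] t01 e0; have /nbhs_ballP [d /= d0 dp] := pc t t01 e e0.
by exists d => // u u01 ut; apply: dp => //; rewrite /ball /= distrC.
Qed.

Lemma is_path_in_of_near (S : set (W -> 'M[R[i]]_n)) p :
  (forall t : R, t \in `[0, 1] -> S (p t)) ->
  (forall t e : R, t \in `[0, 1] -> 0 < e ->
    exists2 d : R, 0 < d & forall u, u \in `[0, 1] -> `|u - t| < d ->
      (supnorm setT (p u \- p t)%R < e%:E)%E) ->
  is_path_in S (p 0) (p 1) p.
Proof.
move=> pS pc; split=> // t t01 e e0; have [d d0 dp] := pc t e t01 e0.
by apply/nbhs_ballP; exists d => //= u; rewrite /ball /= distrC => ut u01; exact: dp.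
Qed.

Lemma same_path_component_mono S S' a b : S `<=` S' ->
  same_path_component S a b -> same_path_component S' a b.
Proof.
by move=> SS [p [p0 p1 pS pc]]; exists p; split=> // t t01; exact/SS/pS.
Qed.

Lemma same_path_component_sym S a b :
  same_path_component S a b -> same_path_component S b a.
Proof.
move=> [p pp]; exists (fun t => p (1 - t)); case: (pp) => p0 p1 pS _.
have -> : b = p (1 - 0) by rewrite subr0.
have -> : a = p (1 - 1) by rewrite subrr.
have flip (t : R) : t \in `[0, 1] -> 1 - t \in `[0, 1].
  by rewrite !in_itv /= => /andP[t0 t1]; rewrite subr_ge0 t1 gerBl.
apply: (@is_path_in_of_near S (fun t => p (1 - t))) => [t /flip|t e /flip t01 e0].
  exact: pS.
have [d d0 dp] := is_path_in_near pp t01 e0.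
exists d => // u /flip u01 ut; apply: dp => //.
by rewrite opprB addrC addrA subrK distrC.
Qed.

Lemma same_path_component_trans S b a c :
  same_path_component S a b -> same_path_component S b c ->
  same_path_component S a c.
Proof.
move=> [p pp] [q qq]; case: (pp) => p0 p1 pS _; case: (qq) => q0 q1 qS _.
pose w (t : R) := if t <= 2^-1 then p (2 * t) else q (2 * t - 1).
have wq (t : R) : 2^-1 <= t -> w t = q (2 * t - 1).
  rewrite /w; case: ifPn => // h1 h2; have -> : t = 2^-1 by lra.
  by rewrite mulfV// subrr p1 q0.
exists w.
have -> : a = w 0 by rewrite /w invr_ge0 ler0n mulr0.
have -> : c = w 1 by rewrite wq; [rewrite mulr1 (_ : 2 - 1 = 1) ?q1//; lra|lra].
have lo (t : R) : t \in `[0, 1] -> t <= 2^-1 -> 2 * t \in `[0, 1].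
  by rewrite !in_itv /= => /andP[*]; apply/andP; split; lra.
have hi (t : R) : t \in `[0, 1] -> 2^-1 <= t -> 2 * t - 1 \in `[0, 1].
  by rewrite !in_itv /= => /andP[*]; apply/andP; split; lra.
apply: is_path_in_of_near => [t t01|t e t01 e0].
  have [h|/ltW h] := leP t 2^-1; last by rewrite wq//; exact/qS/hi.
  by rewrite /w h; exact/pS/lo.
(* On the wrong side of 1/2 the radius is chosen so that no point of the
   half in question is within reach. *)
have [d1 d10 dp] : exists2 d, 0 < d & forall u, u \in `[0, 1] -> u <= 2^-1 ->
    `|u - t| < d -> (supnorm setT (w u \- w t)%R < e%:E)%E.
  have [h|h] := leP t 2^-1.
    have [d d0 dp] := is_path_in_near pp (lo t t01 h) e0.
    exists (d / 2) => [|u u01 uh ut]; first by rewrite divr_gt0.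
    rewrite /w uh h; apply: dp; first exact: lo.
    by rewrite -mulrBr normrM ger0_norm// mulrC -ltr_pdivlMr.
  exists (t - 2^-1) => [|u u01 uh]; first by rewrite subr_gt0.
  by rewrite ltr_norml opprB ltrD2r => /andP[/(le_lt_trans uh)]; rewrite ltxx.
have [d2 d20 dq] : exists2 d, 0 < d & forall u, u \in `[0, 1] -> 2^-1 <= u ->
    `|u - t| < d -> (supnorm setT (w u \- w t)%R < e%:E)%E.
  have [h|h] := leP 2^-1 t.
    have [d d0 dq] := is_path_in_near qq (hi t t01 h) e0.
    exists (d / 2) => [|u u01 uh ut]; first by rewrite divr_gt0.
    rewrite !wq//; apply: dq; first exact: hi.
    have -> : 2 * u - 1 - (2 * t - 1) = 2 * (u - t) by ring.
    by rewrite normrM ger0_norm// mulrC -ltr_pdivlMr.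
  exists (2^-1 - t) => [|u u01 uh]; first by rewrite subr_gt0.
  by rewrite ltr_norml ltrD2r => /andP[_ /(le_lt_trans uh)]; rewrite ltxx.
exists (Num.min d1 d2) => [|u u01]; first by rewrite lt_min d10.
rewrite lt_min => /andP[ud1 ud2].
by have [h|/ltW h] := leP u 2^-1; [exact: dp|exact: dq].
Qed.

End Paths.

Section ProjectionPaths.
Context {R : realType} {n : nat}.

(** Relative to an arbitrary [d], so that it applies to the disjoint union with
    [rho]; continuity follows from the Lipschitz bound. *)
Definition lip_proj (W : Type) (d : W -> W -> R) (K : R) :
    set (W -> 'M[R[i]]_n) :=
  [set w | (forall z, orthoproj (w z)) /\ (lip d setT w < K%:E)%E].

Lemma lip_proj_mono (W : Type) (d : W -> W -> R) (K K' : R) : K <= K' ->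
  lip_proj d K `<=` lip_proj d K'.
Proof. by move=> KK w [wP wK]; split=> //; rewrite (lt_le_trans wK)// lee_fin. Qed.

(** Each value is rounded independently of the others. The Lipschitz estimate for
    rounding makes any such choice continuous, bounds its Lipschitz constants, and
    shows that values that are projections are left alone. *)
Lemma round_path (W : Type) (d : W -> W -> R) (h : R -> W -> 'M[R[i]]_n)
    (delta N K : R) :
  is_metric d -> 0 <= delta -> 2 * delta < 1 -> 0 <= N ->
  N / (1 - 2 * delta) < K ->
  (forall t z, t \in `[0, 1] -> selfadjoint (h t z)) ->
  (forall t z, t \in `[0, 1] ->
     exists2 P, orthoproj P & opnorm (h t z - P) <= delta) ->
  (forall t, t \in `[0, 1] -> lipschitz_le d setT N (h t)) ->
  (forall t e, t \in `[0, 1] -> 0 < e -> exists2 k : R, 0 < k &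
     forall u, u \in `[0, 1] -> `|u - t| < k ->
       forall z, opnorm (h u z - h t z) <= e) ->
  exists2 w, is_path_in (lip_proj d K) (w 0) (w 1) w &
    forall t z, t \in `[0, 1] -> orthoproj (h t z) -> w t z = h t z.
Proof.
move=> dm d0 d1 N0 NK hsa hP hN hc.
have d2 : 0 < 1 - 2 * delta by rewrite subr_gt0.
have [w wP] : {w : R * W -> 'M[R[i]]_n & forall tz, tz.1 \in `[(0:R), 1] ->
    near_proj delta (h tz.1 tz.2) (w tz)}.
  apply: (@choice _ _ (fun tz Q => tz.1 \in `[(0:R), 1] ->
    near_proj delta (h tz.1 tz.2) Q)) => -[t z].
  have [t01|] := boolP (t \in `[0, 1]); last by exists 0.
  have [P PP hPd] := hP t z t01.
  by have [Q [? ? ?]] := spectral_rounding (hsa t z t01) PP d0 hPd; exists Q.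
have wlip t z u y : t \in `[0, 1] -> u \in `[0, 1] ->
    opnorm (w (t, z) - w (u, y)) <= opnorm (h t z - h u y) / (1 - 2 * delta).
  by move=> t01 u01; exact: near_proj_lip d0 (wP (t, z) t01) (wP (u, y) u01) d1.
exists (fun t z => w (t, z)); last first.
  move=> t z t01 hproj.
  have hh : near_proj delta (h t z) (h t z).
    by split=> //; rewrite subrr opnorm0.
  have := near_proj_lip d0 (wP (t, z) t01) hh d1.
  rewrite subrr opnorm0 mul0r => /opnorm_eq0/eqP.
  by rewrite subr_eq0 => /eqP.
apply: (@is_path_in_of_near _ _ _ _ (fun t z => w (t, z))) => [t t01|t e t01 e0].
  split=> [z|]; first by have [] := wP (t, z) t01.
  apply/(lip_ltP _ _ _ dm); exists (N / (1 - 2 * delta)).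
    by rewrite NK andbT divr_ge0// ltW.
  move=> x y _ _; apply: le_trans (wlip _ _ _ _ t01 t01) _.
  by rewrite ler_pdivrMr// mulrAC divfK ?gt_eqF//; exact: hN.
have e1 : 0 < e / 2 * (1 - 2 * delta) by rewrite mulr_gt0 ?divr_gt0.
have [k k0 hk] := hc t _ t01 e1; exists k => // u u01 ut.
apply: (@le_lt_trans _ _ (e / 2)%:E); last first.
  by rewrite lte_fin ltr_pdivrMr// ltr_pMr// ltr1n.
apply: supnorm_le => [|z _]; first by rewrite divr_ge0 ?ltW.
apply: le_trans (wlip _ _ _ _ u01 t01) _.
by rewrite ler_pdivrMr//; exact: hk.
Qed.

(** The segment between the two functions can be rounded, because each of its
    points is within [D / 2] of one of the ends. *)
Lemma close_lip_proj_path (W : Type) (d : W -> W -> R) (K D delta : R)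
    (w0 w1 : W -> 'M[R[i]]_n) :
  is_metric d -> lip_proj d K w0 -> lip_proj d K w1 -> 0 <= D -> D < delta ->
  delta < 1 -> (forall z, opnorm (w0 z - w1 z) <= D) ->
  same_path_component (lip_proj d ((1 - delta)^-1 * K)) w0 w1.
Proof.
move=> dm [w0P /(lip_ltP _ _ _ dm) [N0 /andP[N00 N0K] w0N]].
move=> [w1P /(lip_ltP _ _ _ dm) [N1 /andP[N10 N1K] w1N]] D0 Dd d1 w01.
pose h (t : R) z : 'M[R[i]]_n := w0 z + t%:C *: (w1 z - w0 z).
have hE2 t z : h t z = (1 - t)%:C *: w0 z + t%:C *: w1 z.
  rewrite /h (rmorphB (real_complex R)) rmorph1 scalerBl scale1r scalerBr.
  by rewrite addrA addrAC.
have hE t z : h t z = w1 z + (1 - t)%:C *: (w0 z - w1 z).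
  rewrite hE2 -{2}[t](subKr 1); move: (1 - t) => u.
  rewrite (rmorphB (real_complex R)) rmorph1 scalerBl scale1r scalerBr.
  exact: addrCA.
pose N := Num.max N0 N1.
have NK : N < K by rewrite gt_max N0K.
have Nge : 0 <= N by rewrite le_max N00.
have sa t z : selfadjoint (h t z).
  rewrite /selfadjoint /h linearD /= map_mxD (w0P z).2; congr (_ + _).
  apply: selfadjoint_scale; rewrite /selfadjoint linearB /= map_mxB.
  by rewrite (w0P z).2 (w1P z).2.
have w10 z : opnorm (w1 z - w0 z) <= D by rewrite opnormBC.
have D2 : 0 <= D / 2 by rewrite divr_ge0.
have D21 : 2 * (D / 2) < 1 by rewrite mulrC divfK//; lra.
have NK' : N / (1 - 2 * (D / 2)) < (1 - delta)^-1 * K.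
  have -> : 2 * (D / 2) = D by rewrite mulrC divfK.
  rewrite mulrC; apply: (@lt_le_trans _ _ ((1 - D)^-1 * K)).
    by rewrite ltr_pM2l ?invr_gt0 ?subr_gt0// (lt_trans Dd).
  rewrite ler_wpM2r ?(le_trans Nge (ltW NK))// lef_pV2 ?posrE ?subr_gt0//.
    by rewrite lerB// ltW.
  exact: lt_trans Dd d1.
have [t z t01|t z t01|t t01|t e t01 e0|w wp wh] := round_path dm D2 D21 Nge NK' (h := h).
- exact: sa.
- move: t01; rewrite in_itv /= => /andP[t0 t1].
  have [ht|ht] := leP t (1 / 2).
    exists (w0 z); first exact: w0P.
    rewrite /h addrC addKr; apply: le_trans (opnormZ _ _) _.
    rewrite ger0_norm// mulrC; apply: ler_pM => //; [exact: opnorm_ge0|lra].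
  exists (w1 z); first exact: w1P.
  rewrite hE addrC addKr; apply: le_trans (opnormZ _ _) _.
  rewrite ger0_norm ?subr_ge0// mulrC.
  by apply: ler_pM => //; [exact: opnorm_ge0|lra|lra].
- move: t01; rewrite in_itv /= => /andP[t0 t1] x y _ _.
  have -> : h t x - h t y = (1 - t)%:C *: (w0 x - w0 y) + t%:C *: (w1 x - w1 y).
    by rewrite !hE2 opprD addrACA !scalerBr.
  apply: le_trans (opnormD _ _) _.
  have -> : N * d x y = (1 - t) * (N * d x y) + t * (N * d x y) by ring.
  apply: lerD.
    apply: le_trans (opnormZ _ _) _; rewrite ger0_norm ?subr_ge0//.
    rewrite ler_wpM2l ?subr_ge0//; apply: le_trans (w0N x y I I) _.
    by rewrite ler_wpM2r ?is_metric_ge0// le_max lexx.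
  apply: le_trans (opnormZ _ _) _; rewrite ger0_norm//.
  rewrite ler_wpM2l//; apply: le_trans (w1N x y I I) _.
  by rewrite ler_wpM2r ?is_metric_ge0// le_max lexx orbT.
- exists (e / (D + 1)); first by rewrite divr_gt0// ltr_wpDl.
  move=> u u01 ut z.
  have -> : h u z - h t z = (u - t)%:C *: (w1 z - w0 z).
    by rewrite /h opprD addrACA subrr add0r -scalerBl (rmorphB (real_complex R)).
  apply: le_trans (opnormZ _ _) _.
  have -> : e = e / (D + 1) * (D + 1) by rewrite divfK// gt_eqF// ltr_wpDl.
  apply: ler_pM => //; [exact: opnorm_ge0|exact: ltW|].
  by apply: le_trans (w10 z) _; rewrite lerDl.
exists w.
have -> : w0 = w 0.
  apply/funext => z; rewrite wh ?in_itv/= ?lexx ?ler01// /h ?scale0r ?addr0//.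
have -> : w1 = w 1.
  apply/funext => z; rewrite wh ?in_itv/= ?lexx ?ler01// hE subrr ?scale0r ?addr0//.
exact: wp.
Qed.

Lemma lip_proj_restrict (W : Type) (d : W -> W -> R) (K : R) (V : metricType R)
    (f : V -> W) (w : W -> 'M[R[i]]_n) :
  is_metric d -> (forall x y, d (f x) (f y) = mdist x y) -> lip_proj d K w ->
  ProjLt K (w \o f).
Proof.
move=> dm fE [wP /(lip_ltP _ _ _ dm) [N NK wN]].
have fN : lipschitz_le mdist setT N (w \o f).
  by move=> x y _ _; rewrite -fE; exact: wN.
have lK : (lip mdist [set: V] (w \o f) < K%:E)%E.
  by apply/(lip_ltP _ _ _ (@mdist_is_metric _ V)); exists N.
split=> //; split; last by rewrite (lt_trans lK)// ltry.
by split=> [|x|x]; [exact: lipschitz_continuous fN|exact: (wP _).1|exact: (wP _).2].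
Qed.

Lemma path_restrict (W : Type) (d : W -> W -> R) (K : R) (V : metricType R)
    (f : V -> W) (w : R -> W -> 'M[R[i]]_n) w0 w1 :
  is_metric d -> (forall x y, d (f x) (f y) = mdist x y) ->
  is_path_in (lip_proj d K) w0 w1 w ->
  is_path_in (@Proj R V n) (w0 \o f) (w1 \o f) (fun t => w t \o f).
Proof.
move=> dm fE [<- <- wK wc]; split=> // t t01 => [|e e0].
  by have [] := lip_proj_restrict dm fE (wK t t01).
have := wc t t01 e e0; apply: filterS => u; apply: le_lt_trans.
apply: le_ereal_sup => _ [->|[x _ <-]]; first by left.
by right; exists (f x).
Qed.

End ProjectionPaths.

(** * Isomorphism of bundles along a path *)

Section Bundles.
Context {R : realType} {n : nat}.

Lemma bundle_isomorphic_trans (W : topologicalType) (q p s : W -> 'M[R[i]]_n) :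
  bundle_isomorphic p q -> bundle_isomorphic q s -> bundle_isomorphic p s.
Proof.
have comp (p1 p2 p3 : W -> 'M[R[i]]_n) f g : bundle_map p1 p2 f ->
    bundle_map p2 p3 g -> bundle_map p1 p3 (fun x => g x \o f x).
  move=> [f1 fl fc] [g1 gl gc]; split=> [x v vp|x a u v up vp|x v vp e e0] /=.
  - exact/g1/f1.
  - by rewrite fl// gl//; exact: f1.
  - have [d d0 gd] := gc x (f x v) (f1 _ _ vp) e e0.
    have [k k0 fk] := fc x v vp d d0; exists k => //.
    near=> y => w wp wv; apply: (near gd y) => //; first exact: f1.
    exact: (near fk y).
move=> [f [f' [pf qf' ff' f'f]]] [g [g' [qg sg' gg' g'g]]].
exists (fun x => g x \o f x), (fun x => f' x \o g' x).
split; [exact: comp pf qg|exact: comp sg' qf'| |] => x v vp /=.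
- by rewrite gg' ?ff'//; case: pf => h _ _; exact: h.
- by rewrite f'f ?g'g//; case: sg' => h _ _; exact: h.
Unshelve. all: by end_near. Qed.

Section Intertwiner.
Implicit Types (a b : 'M[R[i]]_n) (v : 'cV[R[i]]_n).

(** It satisfies [b u = u a], so it maps the range of [a] to that of [b]. *)
Definition intertwiner a b : 'M[R[i]]_n :=
  b *m a + (1%:M - b) *m (1%:M - a).

Lemma intertwiner_mull a b : orthoproj b -> b *m intertwiner a b = b *m a.
Proof.
move=> [bb _]; rewrite /intertwiner mulmxDr !mulmxA bb (mulmxBr b) mulmx1 bb subrr mul0mx.
exact: addr0.
Qed.

Lemma intertwiner_mulr a b : orthoproj a -> intertwiner a b *m a = b *m a.
Proof.
move=> [aa _]; rewrite /intertwiner mulmxDl -!mulmxA aa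
  [(1%:M - a) *m a]mulmxBl mul1mx aa subrr mulmx0.
exact: addr0.
Qed.

(** Both [b (u v) = b a v] and [u v - b u v = (1 - b) (1 - a) v] are nearly as
    long as [a v] and [v - a v], and both pairs are orthogonal. *)
Lemma intertwiner_lbound a b (D : R) v : orthoproj a -> orthoproj b -> D < 1 ->
  opnorm (a - b) <= D -> (1 - D) * cvnorm v <= cvnorm (intertwiner a b *m v).
Proof.
move=> ha hb D1 abD; set u := intertwiner a b.
have D0 : 0 <= 1 - D by rewrite subr_ge0 ltW.
have lb w z : w = z + (a - b) *m w \/ w = z + (b - a) *m w ->
    (1 - D) * cvnorm w <= cvnorm z.
  have arith (x y t : R) : x <= y + t -> t <= D * x -> (1 - D) * x <= y.
    by clear; move=> *; lra.
  case=> wE.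
    have h := cvnormD z ((a - b) *m w); rewrite -wE in h; apply: arith h _.
    exact: le_trans (cvnorm_mulmx _ _) (ler_wpM2r (cvnorm_ge0 w) abD).
  have h := cvnormD z ((b - a) *m w); rewrite -wE in h; apply: arith h _.
  rewrite opnormBC in abD.
  exact: le_trans (cvnorm_mulmx _ _) (ler_wpM2r (cvnorm_ge0 w) abD).
have h1 : (1 - D) * cvnorm (a *m v) <= cvnorm (b *m (u *m v)).
  apply: lb; left; rewrite mulmxA intertwiner_mull// -!mulmxA -mulmxDl.
  rewrite addrC subrK mulmxA ha.1; reflexivity.
have h2 : (1 - D) * cvnorm (v - a *m v) <= cvnorm (u *m v - b *m (u *m v)).
  set w := v - a *m v.
  have aw : a *m w = 0 by rewrite mulmxBr mulmxA ha.1 subrr.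
  have -> : u *m v - b *m (u *m v) = w - b *m w.
    rewrite (mulmxA b) intertwiner_mull// /u /intertwiner mulmxDl addrC addKr.
    rewrite -mulmxA mulmxBl mul1mx mulmxBl mul1mx; reflexivity.
  apply: lb; right; rewrite mulmxBl aw subr0 subrK; reflexivity.
rewrite -[X in X <= _]ger0_norm ?mulr_ge0 ?cvnorm_ge0//.
rewrite -ler_sqr ?nnegrE ?cvnorm_ge0// real_normK ?num_real//.
rewrite exprMn (cvnorm_orthoproj v ha) (cvnorm_orthoproj (u *m v) hb) mulrDr -!exprMn.
by apply: lerD; apply: lerXn2r; rewrite ?nnegrE ?mulr_ge0 ?cvnorm_ge0.
Qed.

Lemma intertwiner_unit a b (D : R) : orthoproj a -> orthoproj b -> D < 1 ->
  opnorm (a - b) <= D -> intertwiner a b \in unitmx.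
Proof.
move=> ha hb D1 abD; rewrite -unitmx_tr -row_free_unit -kermx_eq0.
apply/eqP/row_matrixP => i; rewrite row0; set k := row i _.
have k0 : k *m (intertwiner a b)^T = 0 by apply/sub_kermxP; exact: row_sub.
have : intertwiner a b *m k^T = 0 by rewrite -[LHS]trmxK trmx_mul trmxK k0 trmx0.
move=> uk; have := intertwiner_lbound k^T ha hb D1 abD.
rewrite uk cvnorm0 pmulr_rle0 ?subr_gt0// => /cvnorm_eq0 /(congr1 trmx).
by rewrite trmxK trmx0.
Qed.

Lemma intertwiner_dist a b a' b' : orthoproj a -> orthoproj b ->
  orthoproj a' -> orthoproj b' ->
  opnorm (intertwiner a b - intertwiner a' b') <=
    2 * (opnorm (a - a') + opnorm (b - b')).
Proof.
have key c d c' d' : orthoproj c -> orthoproj d -> orthoproj c' -> orthoproj d' ->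
    opnorm (d *m c - d' *m c') <= opnorm (c - c') + opnorm (d - d').
  move=> hc hd hc' hd'.
  have -> : d *m c - d' *m c' = d *m (c - c') + (d - d') *m c'.
    by rewrite mulmxBr mulmxBl addrA subrK.
  apply: le_trans (opnormD _ _) _; apply: lerD; apply: le_trans (opnormM _ _) _.
    exact: ler_piMl (opnorm_ge0 _) (opnorm_orthoproj hd).
  exact: ler_piMr (opnorm_ge0 _) (opnorm_orthoproj hc').
move=> ha hb ha' hb'.
have -> : intertwiner a b - intertwiner a' b' = (b *m a - b' *m a') +
    ((1%:M - b) *m (1%:M - a) - (1%:M - b') *m (1%:M - a')).
  by rewrite /intertwiner opprD addrACA.
apply: le_trans (opnormD _ _) _; rewrite mulr_natl mulr2n; apply: lerD.
  exact: key.
have compl (c d : 'M[R[i]]_n) : opnorm (c - d) = opnorm ((1%:M - c) - (1%:M - d)).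
  by rewrite opnormBC; congr opnorm; rewrite opprB [RHS]addrC addrA subrK.
rewrite (compl a) (compl b).
by apply: key; exact: orthoprojC.
Qed.

End Intertwiner.

Lemma fiberP (W : Type) (p : W -> 'M[R[i]]_n) x v : p x *m p x = p x ->
  fiber p x v <-> p x *m v = v.
Proof.
move=> pp; split=> [[w _ <-]|h]; first by rewrite mulmxA pp.
by exists v.
Qed.

Lemma mx_continuous_near (W : topologicalType) (f : W -> 'M[R[i]]_n) x (e : R) :
  mx_continuous_on setT f -> 0 < e -> \forall y \near x, opnorm (f y - f x) < e.
Proof.
move=> fc e0; have := fc x I e e0; rewrite near_withinE.
by apply: filterS => y; exact.
Qed.

(** The intertwiner of [p x] and [q x] is invertible and restricts to the map
    [v |-> q x v] between the fibres. The lower bound on the intertwiner gives the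
    continuity of the inverse. *)
Lemma bundle_isomorphic_close (W : topologicalType) (p q : W -> 'M[R[i]]_n) (D : R) :
  is_projection p -> is_projection q -> D < 1 ->
  (forall x, opnorm (p x - q x) <= D) -> bundle_isomorphic p q.
Proof.
move=> [pc pp ps] [qc qq qs] D1 pqD.
have hp x : orthoproj (p x) by split.
have hq x : orthoproj (q x) by split.
pose u x := intertwiner (p x) (q x).
have uu x : u x \in unitmx := intertwiner_unit (hp x) (hq x) D1 (pqD x).
have qu x : q x *m u x = q x *m p x := intertwiner_mull _ (hq x).
have up x : u x *m p x = q x *m p x := intertwiner_mulr _ (hp x).
pose phi x (v : 'cV[R[i]]_n) := q x *m v.
pose psi x (w : 'cV[R[i]]_n) := invmx (u x) *m w.
have psip x w : fiber q x w -> p x *m psi x w = psi x w.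
  move=> /(fiberP _ (qq x)) wq; rewrite /psi -{2}wq.
  rewrite -[LHS](mulKmx (uu x)); congr (_ *m _).
  rewrite mulmxA up -qu -mulmxA mulKVmx//.
have psiK x w : fiber q x w -> u x *m psi x w = w by move=> _; rewrite mulKVmx.
have phiE x v : fiber p x v -> u x *m v = phi x v.
  move=> /(fiberP _ (pp x)) vp; rewrite /phi -{1}vp mulmxA up -mulmxA vp; reflexivity.
have qphi x v : fiber p x v -> fiber q x (phi x v) by move=> _; exists v.
exists phi, psi; split.
- split=> // [x a v w _ _|x v _ e e0]; first by rewrite /phi mulmxDr scalemxAr.
  have e2 : 0 < e / 2 by rewrite divr_gt0.
  exists (e / 2) => //.
  have v1 : 0 < cvnorm v + 1 by rewrite ltr_wpDl ?cvnorm_ge0.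
  have := mx_continuous_near x qc (divr_gt0 e2 v1); apply: filterS => y qxy w _ wv.
  have -> : phi y w - phi x v = q y *m (w - v) + (q y - q x) *m v.
    by rewrite /phi mulmxBr mulmxBl addrA subrK.
  apply: le_lt_trans (cvnormD _ _) _; rewrite (splitr e); apply: ler_ltD.
    exact: le_trans (cvnorm_orthoproj_le _ (hq y)) (ltW wv).
  apply: le_lt_trans (cvnorm_mulmx _ _) _.
  have -> : e / 2 = e / 2 / (cvnorm v + 1) * (cvnorm v + 1).
    by rewrite divfK// gt_eqF.
  apply: (@le_lt_trans _ _ (opnorm (q y - q x) * (cvnorm v + 1))).
    by rewrite ler_wpM2l ?opnorm_ge0// lerDl.
  by rewrite ltr_pM2r.
- split=> [x w wq|x a v w _ _|x w wq e e0].
  + apply/(fiberP _ (pp x)); exact: psip.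
  + by rewrite /psi mulmxDr scalemxAr.
  have k0 : 0 < 1 - D by rewrite subr_gt0.
  pose v := psi x w; have uv : u x *m v = w by exact: psiK.
  have v1 : 0 < cvnorm v + 1 by rewrite ltr_wpDl ?cvnorm_ge0.
  pose eta := e * (1 - D) / 8 / (cvnorm v + 1).
  have eta0 : 0 < eta by rewrite /eta !divr_gt0 ?mulr_gt0.
  exists (e * (1 - D) / 2); first by rewrite divr_gt0 ?mulr_gt0.
  move: (mx_continuous_near x pc eta0) (mx_continuous_near x qc eta0).
  apply: filterS2 => y pxy qxy w' w'q ww'.
  have h1 := intertwiner_lbound (psi y w' - v) (hp y) (hq y) D1 (pqD y).
  have E : u y *m (psi y w' - v) = (w' - w) + (u x - u y) *m v.
    by rewrite mulmxBr psiK// mulmxBl uv addrA subrK.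
  rewrite -/(u y) E in h1.
  have h2 := cvnormD (w' - w) ((u x - u y) *m v).
  have h3 : cvnorm ((u x - u y) *m v) <= e * (1 - D) / 2.
    apply: le_trans (cvnorm_mulmx _ _) _.
    have h4 := intertwiner_dist (hp x) (hq x) (hp y) (hq y).
    rewrite (opnormBC (p x)) (opnormBC (q x)) in h4.
    have h5 : opnorm (u x - u y) <= 4 * eta.
      have arith (r s t : R) : r <= 2 * (s + t) -> s < eta -> t < eta -> r <= 4 * eta.
        by clear; move=> *; lra.
      exact: arith h4 pxy qxy.
    apply: (@le_trans _ _ (4 * eta * (cvnorm v + 1))).
      by apply: ler_pM h5 _; rewrite ?opnorm_ge0 ?cvnorm_ge0// lerDl.
    have -> : 4 * eta * (cvnorm v + 1) = e * (1 - D) / 2.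
      by rewrite /eta; field; rewrite gt_eqF.
    exact: lexx.
  have arith (r s t : R) : (1 - D) * r <= t -> t <= s + e * (1 - D) / 2 ->
      s < e * (1 - D) / 2 -> r < e.
    move=> a1 a2 a3; rewrite -(ltr_pM2l k0).
    by clear -a1 a2 a3; lra.
  apply: arith h1 _ ww'; apply: le_trans h2 _; exact: lerD.
- move=> x v vp; rewrite -phiE// /psi mulKmx//.
- move=> x w wq; rewrite -phiE ?psiK//.
  apply/(fiberP _ (pp x)); exact: psip.
Qed.

(** Bundles at nearby times are isomorphic, so the set of times whose bundle is
    isomorphic to the first one contains its supremum and cannot stop there. *)
Lemma bundle_isomorphic_path (W : metricType R) (q0 q1 : W -> 'M[R[i]]_n) :
  same_path_component (@Proj R W n) q0 q1 -> bundle_isomorphic q0 q1.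
Proof.
move=> [q qq]; case: (qq) => q0E q1E qS _.
have qP t : t \in `[(0 : R), 1] -> is_projection (q t) by move=> /qS[].
have close c : c \in `[(0:R), 1] -> exists2 d : R, 0 < d &
    forall u, u \in `[0, 1] -> `|u - c| < d ->
    bundle_isomorphic (q c) (q u) /\ bundle_isomorphic (q u) (q c).
  move=> c01; have half : 0 < 2^-1 :> R by rewrite invr_gt0.
  have [d d0 dp] := is_path_in_near qq c01 half; exists d => // u u01 uc.
  have cu x : opnorm (q u x - q c x) <= 2^-1.
    exact: ltW (supnorm_lt (dp u u01 uc) (I : setT x)).
  have h1 : (2^-1 : R) < 1 by rewrite invf_lt1// ltr1n.
  split; last exact: bundle_isomorphic_close (qP u u01) (qP c c01) h1 cu.
  apply: (bundle_isomorphic_close (qP c c01) (qP u u01) h1) => x.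
  rewrite opnormBC; exact: cu.
have I0 : (0 : R) \in `[0, 1] by rewrite in_itv /= lexx ler01.
pose E := [set t : R | t \in `[0, 1] /\ bundle_isomorphic (q 0) (q t)].
have E0 : E 0.
  split=> //; have [d d0 h] := close 0 I0.
  by have [] := h 0 I0; rewrite ?subrr ?normr0.
have Eub : has_ubound E by exists 1 => t [/itvP t01 _]; rewrite t01.
have supE : has_sup E by split=> //; exists 0.
have c01 : sup E \in `[0, 1].
  rewrite in_itv /=; apply/andP; split; first exact: sup_upper_bound.
  by apply: ge_sup; [exists 0|move=> t [/itvP t01 _]; rewrite t01].
have [d d0 near_c] := close (sup E) c01.
have Ec : bundle_isomorphic (q 0) (q (sup E)).
  have [t [t01 Et] ct] := sup_adherent d0 supE.
  have tc : t <= sup E by apply: sup_upper_bound.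
  have tcd : `|t - sup E| < d.
    by rewrite ler0_norm ?subr_le0// opprB ltrBlDr addrC -ltrBlDr.
  have [_ h] := near_c t t01 tcd; exact: bundle_isomorphic_trans Et h.
have c1 : sup E = 1.
  apply/eqP; rewrite eq_le; apply/andP; split; first by move/itvP: c01 => ->.
  rewrite leNgt; apply/negP => c1.
  pose u := Num.min 1 (sup E + d / 2).
  have cu : sup E < u by rewrite lt_min c1 ltrDl divr_gt0.
  have u01 : u \in `[0, 1].
    rewrite in_itv /= ge_min lexx andbT (le_trans _ (ltW cu))//.
    by move/itvP: c01 => ->.
  suff : E u by move/(sup_upper_bound supE); rewrite leNgt cu.
  split=> //; apply: bundle_isomorphic_trans Ec _; apply: (near_c u u01 _).1.
  rewrite gtr0_norm ?subr_gt0// ltrBlDl (@le_lt_trans _ _ (sup E + d / 2))//.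
    by rewrite ge_min lexx orbT.
  by rewrite ltrD2l ltr_pdivrMr// ltr_pMr// ltr1n.
by rewrite -q0E -q1E -c1.
Qed.

End Bundles.

(** * Lifting a path of projections to the union *)

Section Lifting.
Context {R : realType}.

(** The choice [c < lambda (1 + 5 eps lambda r)] leaves room in the passage from
    the rounding factor [1 - 2 c r e] to [1 - 12 eps lambda r]. *)
Lemma rounding_constant (L r eps e c : R) : 0 < L -> 0 < r -> 0 < e -> e < eps ->
  eps * L * r < 1 / 14 -> 0 <= c -> c < L * (1 + 5 * (eps * L * r)) ->
  2 * (c * r * e) < 1 /\
  c * r / (1 - 2 * (c * r * e)) < L * r * (1 - 12 * eps * L * r)^-1.
Proof.
move=> L0 r0 e0 ee; set D := eps * L * r => D14 c0 cL.
have eps0 : 0 < eps by exact: lt_trans ee.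
have D0 : 0 < D by rewrite /D !mulr_gt0.
have cre : c * r * e <= D * (1 + 5 * D).
  have -> : D * (1 + 5 * D) = L * (1 + 5 * D) * r * eps by rewrite {1}/D; ring.
  apply: ler_pM; [exact: mulr_ge0 c0 (ltW r0)|exact: ltW| |exact: ltW].
  by rewrite ler_wpM2r// ltW.
have DD : D * (1 + 5 * D) < 1 / 14 * (1 + 5 / 14).
  by apply: ltr_pM; lra.
have h1 : 2 * (c * r * e) < 1 by lra.
split=> //.
have -> : 12 * eps * L * r = 12 * D by rewrite /D; ring.
have p1 : 0 < 1 - 12 * D by lra.
have p2 : 0 < 1 - 2 * (c * r * e) by lra.
rewrite ltr_pdivrMr// mulrAC ltr_pdivlMr//.
apply: (@lt_le_trans _ _ (L * (1 + 5 * D) * r * (1 - 12 * D))).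
  by rewrite ltr_pM2r// ltr_pM2r.
have -> : L * (1 + 5 * D) * r * (1 - 12 * D) =
  L * r * ((1 + 5 * D) * (1 - 12 * D)) by ring.
rewrite ler_pM2l ?mulr_gt0//.
have -> : (1 + 5 * D) * (1 - 12 * D) = 1 - 7 * D - 60 * D ^+ 2 by ring.
have : D * (1 + 5 * D) = D + 5 * D ^+ 2 by ring.
have := sqr_ge0 D; move: (D ^+ 2) (D * (1 + 5 * D)) cre => D2 DDD.
by clear -D0 => *; lra.
Qed.

Context {X Y : metricType R} {n : nat}.
Variable rho : (X + Y)%type -> (X + Y)%type -> R.
Hypotheses (cX : compact [set: X]) (cY : compact [set: Y]).
Hypotheses (dm : is_metric rho).
Hypotheses (rhoX : forall x x' : X, rho (inl x) (inl x') = mdist x x')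
  (rhoY : forall y y' : Y, rho (inr y) (inr y') = mdist y y').

Let Z := metrized dm.
Let inX : X -> Z := inl.
Let inY : Y -> Z := inr.

Let compact_image (V : metricType R) (f : V -> Z) : compact [set: V] ->
  (forall x y, rho (f x) (f y) = mdist x y) -> compact (range f).
Proof.
move=> cV fE; apply: continuous_compact cV.
exact/continuous_subspaceT/isometry_continuous.
Qed.

Lemma compact_metrized_sum : compact [set: Z].
Proof.
have -> : [set: Z] = range inX `|` range inY.
  by apply/seteqP; split=> // -[x|y] _; [left; exists x|right; exists y].
by apply: compactU; exact: compact_image.
Qed.

Lemma closed_metrized_inl : closed (range inX).
Proof.
apply: compact_closed; first exact: metric_hausdorff.
exact: compact_image.
Qed.

(** A path on [X] as a function on the subset [X x [0, 1]] of [Z x [0, 1]], in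
    the form in which extension theorems take it: total, with the value 0 at the
    points where it is to be extended. *)
Definition path_on_sum (p : R -> X -> 'M[R[i]]_n) (zt : Z * @uitv R) : 'M[R[i]]_n :=
  match zt.1 : (X + Y)%type with inl x => p (set_val zt.2) x | inr _ => 0 end.

Lemma path_on_sum_continuous (r : R) (p : R -> X -> 'M[R[i]]_n) p0 p1 : 0 < r ->
  is_path_in (ProjLt r) p0 p1 p ->
  mx_continuous_on (range inX `*` setT) (path_on_sum p).
Proof.
move=> r0 pp [z0 t] [/= [x _ xz] _] e e0; rewrite -xz {z0 xz}; case: (pp) => _ _ pS pc.
have e2 : 0 < e / 2 by rewrite divr_gt0.
have t01 : set_val t \in `[0, 1] := set_valP t.
have [_ /(lip_ltP _ _ _ (@mdist_is_metric _ X)) [N /andP[N0 Nr] pN]] := pS _ t01.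
have nt0 := pc _ t01 _ e2; rewrite near_withinE in nt0.
pose A := [set v : R | (supnorm [set: X] (p v \- p (set_val t))%R < (e / 2)%:E)%E].
have nt : nbhs t (set_val @^-1` A).
  have : nbhs t (set_val @^-1` [set v : R | v \in `[0, 1] -> A v]).
    exact: (@initial_continuous _ _ (set_val : @uitv R -> R) t _ nt0).
  by apply: filterS => u /= h; exact: h (set_valP u).
have nz : \forall z \near inX x, mdist (inX x) z < e / 2 / r.
  apply/nbhs_ballP; exists (e / 2 / r); first by rewrite /= divr_gt0.
  by move=> z; rewrite ballEmdist.
exists ([set z | mdist (inX x) z < e / 2 / r], set_val @^-1` A) => //.
move=> [z u] /= [hz hu] [/= [x' _ xz] _]; move: hz; rewrite -{z}xz => hz.
have -> : path_on_sum p (inX x', u) = p (set_val u) x' by [].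
have -> : path_on_sum p (inX x, t) = p (set_val t) x by [].
apply: le_lt_trans (opnorm_triangle (p (set_val t) x') _ _) _.
rewrite (splitr e); apply: ltrD; first exact: supnorm_lt hu (I : setT x').
apply: le_lt_trans (pN _ _ I I) _; rewrite metric_sym -rhoX.
apply: (@le_lt_trans _ _ (r * rho (inl x) (inl x'))).
  by rewrite ler_wpM2r ?is_metric_ge0// ltW.
by rewrite mulrC -ltr_pdivlMr.
Qed.

(** Extend the path to [Z x [0, 1]] with a constant [c] close to [lambda n], then
    round: a point of [Y] is within [e] of a point [x] of [X], so that the extended
    value there is within [c r e] of the projection [p t x]. *)
Lemma lift_path (r eps e : R) (p : R -> X -> 'M[R[i]]_n) p0 p1 :
  (0 < n)%N -> 0 < r -> 0 < e -> e < eps -> eps * lambda n * r < 1 / 14 ->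
  (forall y, exists x, rho (inl x) (inr y) < e) ->
  is_path_in (ProjLt r) p0 p1 p ->
  exists2 w, is_path_in (lip_proj rho
      (lambda n * r * (1 - 12 * eps * lambda n * r)^-1)) (w 0) (w 1) w &
    forall t x, t \in `[0, 1] -> w t (inl x) = p t x.
Proof.
move=> n0 r0 e0 ee small XY pp; case: (pp) => _ _ pS _.
have L0 : 0 < lambda n :> R by exact: lambda_gt0.
have eps0 : 0 < eps by exact: lt_trans ee.
have [c cext cL] : exists2 c : R, extension_constant n c &
    c < lambda n * (1 + 5 * (eps * lambda n * r)).
  by apply: lambda_approx; rewrite ltr_pMr// ltrDl !mulr_gt0.
have c1 : 1 <= c by exact: extension_constant_ge1 cext.
have c0 : 0 <= c by exact: le_trans c1.
have [d1 NK] := rounding_constant L0 r0 e0 ee small c0 cL.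
have sa z t : range inX z -> selfadjoint (path_on_sum p (z, t)).
  move=> [x _ <-]; have [[[_ _ ps] _] _] := pS _ (set_valP t); exact: ps.
have plip t : (lip mdist (range inX) (fun z => path_on_sum p (z, t)) <= r%:E)%E.
  apply/(lip_leP _ _ _ (@mdist_is_metric _ Z)); split; first exact: ltW.
  move=> _ _ [x _ <-] [x' _ <-].
  have [_ /(lip_ltP _ _ _ (@mdist_is_metric _ X)) [N /andP[N0 Nr] pN]] :=
    pS _ (set_valP t).
  apply: le_trans (pN x x' I I) _; rewrite mdist_metrized /inX rhoX.
  by rewrite ler_wpM2r ?mdist_ge0// ltW.
have [G [Gc Gsa GF Glip _]] := cext Z (range inX) (@uitv R) (path_on_sum p) r
  compact_metrized_sum closed_metrized_inl compact_uitv
  (path_on_sum_continuous r0 pp) (fun x t Xx => sa x t Xx) plip.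
pose h (t : R) (z : X + Y) : 'M[R[i]]_n := G (z : Z, clamp t).
have hX t x : t \in `[0, 1] -> h t (inl x) = p t x.
  move=> t01; rewrite /h -[X in p X]clamp_id//; apply: (GF (inX x)).
  by exists x.
have pP t x : t \in `[0, 1] -> orthoproj (p t x).
  by move=> /pS[[[_ pp' ps] _] _]; split; [exact: pp'|exact: ps].
have hlip t : lipschitz_le rho setT (c * r) (h t).
  have /(lip_leP _ _ _ (@mdist_is_metric _ Z)) [_ GN] := Glip (clamp t).
  by move=> z z' _ _; exact: (GN z z' I I).
have cr0 : 0 <= c * r by rewrite mulr_ge0// ltW.
have cre0 : 0 <= c * r * e by rewrite mulr_ge0// ltW.
have [t z t01|t z t01|t t01|t k t01 k0|w wp wh] :=
  round_path dm cre0 d1 cr0 NK (h := h).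
- exact: Gsa.
- case: z => [x|y].
    exists (p t x); first exact: pP.
    by rewrite hX// subrr opnorm0.
  have [x xy] := XY y; exists (p t x); first exact: pP.
  rewrite -hX// opnormBC; apply: le_trans (hlip t _ _ I I) _.
  by rewrite ler_wpM2l// ltW.
- exact: hlip.
- have := near_uniform (clamp t) compact_metrized_sum _ k0 (F := G).
  rewrite setXTT => /(_ Gc) nG.
  have [d d0 dG] := nbhs_clamp nG.
  by exists d => // u _ ut z; exact: dG u ut z I.
exists w => // t x t01; rewrite wh ?hX//; exact: pP.
Qed.

End Lifting.

Unset Implicit Arguments.

Theorem theorem6p5 (R : realType) (X Y : metricType R)
    (rho : (X + Y)%type -> (X + Y)%type -> R) (n : nat) (r eps : R) :
  compact [set: X] -> compact [set: Y] ->
  is_metric rho ->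
  (forall x x' : X, rho (inl x) (inl x') = mdist x x') ->
  (forall y y' : Y, rho (inr y) (inr y') = mdist y y') ->
  (0 < n)%N ->
  0 < r ->
  eps * lambda n * r < 1 / 14 ->
  let s := lambda n * r * (1 - 12 * eps * lambda n * r)^-1 in
  eps * s < 1 / 2 /\
  ((hausdorff_dist rho (range inl) (range inr) < eps%:E)%E ->
   forall p0 p1 : X -> 'M[R[i]]_n,
   ProjLt r p0 -> ProjLt r p1 ->
   same_path_component (ProjLt r) p0 p1 ->
   (exists q0 q1 : Y -> 'M[R[i]]_n,
      [/\ ProjLt s q0, ProjLt s q1,
          (lip rho setT (dsum p0 q0) < s%:E)%E &
          (lip rho setT (dsum p1 q1) < s%:E)%E]) /\
   (forall q0 q1 : Y -> 'M[R[i]]_n,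
      ProjLt s q0 -> ProjLt s q1 ->
      (lip rho setT (dsum p0 q0) < s%:E)%E ->
      (lip rho setT (dsum p1 q1) < s%:E)%E ->
      (forall delta : R, 2 * eps * s < delta -> delta < 1 ->
         exists (p : R -> X -> 'M[R[i]]_n) (q : R -> Y -> 'M[complex R]_n),
           [/\ is_path_in (@Proj R X n) p0 p1 p,
               is_path_in (@Proj R Y n) q0 q1 q &
               forall t : R, t \in `[0, 1] ->
                 (lip rho setT (dsum (p t) (q t)) < ((1 - delta)^-1 * s)%:E)%E]) /\
      bundle_isomorphic q0 q1)).
Proof.
move=> cX cY dm rhoX rhoY n0 r0 small s.
have L0 : 0 < lambda n :> R by exact: lambda_gt0.
have p12 : 0 < 1 - 12 * eps * lambda n * r.
  have -> : 12 * eps * lambda n * r = 12 * (eps * lambda n * r) by ring.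
  lra.
have s0 : 0 < s by rewrite !mulr_gt0// invr_gt0.
have epss : eps * s < 1 / 2.
  have -> : eps * s = eps * lambda n * r / (1 - 12 * eps * lambda n * r).
    by rewrite /s; ring.
  rewrite ltr_pdivrMr//.
  have -> : 12 * eps * lambda n * r = 12 * (eps * lambda n * r) by ring.
  lra.
split=> // hdist p0 p1 p0r p1r [p pp].
have [e [e0 ee YX]] : exists e : R, [/\ 0 < e, e < eps &
    forall y, exists x, rho (inl x) (inr y) < e].
  have [_ [e [e0 _ YX] <-]] := ereal_inf_lt hdist; rewrite lte_fin => ee.
  exists e; split=> // y; have [_ [x _ <-] xy] := YX (inr y) (ex_intro2 _ _ y I erefl).
  by exists x.
have [w wp wX] := lift_path cX cY dm rhoX rhoY n0 r0 e0 ee small YX pp.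
rewrite -/s in wp.
have I0 : (0 : R) \in `[0, 1] by rewrite in_itv /= lexx ler01.
have I1 : (1 : R) \in `[0, 1] by rewrite in_itv /= lexx ler01.
case: (pp) => p0E p1E _ _; case: (wp) => _ _ wS _.
have w0E : w 0 = dsum p0 (w 0 \o inr).
  by apply/funext => -[x|y] //=; rewrite wX// p0E.
have w1E : w 1 = dsum p1 (w 1 \o inr).
  by apply/funext => -[x|y] //=; rewrite wX// p1E.
split.
  exists (w 0 \o inr), (w 1 \o inr); split.
  - exact: lip_proj_restrict dm rhoY (wS 0 I0).
  - exact: lip_proj_restrict dm rhoY (wS 1 I1).
  - by rewrite -w0E; exact: (wS 0 I0).2.
  - by rewrite -w1E; exact: (wS 1 I1).2.
move=> q0 q1 q0s q1s pq0 pq1.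
have proj_dsum (p' : X -> 'M[R[i]]_n) (q' : Y -> 'M[R[i]]_n) : ProjLt r p' ->
    ProjLt s q' -> (lip rho setT (dsum p' q') < s%:E)%E -> lip_proj rho s (dsum p' q').
  move=> [[[_ pp' ps'] _] _] [[[_ qq' qs'] _] _] pq'; split=> //.
  by move=> [x|y]; split=> /=.
(* Both functions agree on [X], and a point of [Y] is within [e] of [X]. *)
have close (p' : X -> 'M[R[i]]_n) (q' : Y -> 'M[R[i]]_n) (v : X + Y -> 'M[R[i]]_n) :
    lip_proj rho s (dsum p' q') -> lip_proj rho s v -> (forall x, v (inl x) = p' x) ->
    forall z, opnorm (dsum p' q' z - v z) <= 2 * e * s.
  move=> [_ /(lip_ltP _ _ _ dm) [N /andP[N0 Ns] pqN]].
  move=> [_ /(lip_ltP _ _ _ dm) [N' /andP[N'0 N's] vN]] vp.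
  have es0 : 0 <= e * s by rewrite mulr_ge0 ?ltW.
  case=> [x|y]; first by rewrite /= vp subrr opnorm0 -mulrA mulr_ge0.
  have [x xy] := YX y.
  have bound (M : R) : 0 <= M -> M < s -> M * rho (inl x) (inr y) <= e * s.
    by move=> M0 Ms; rewrite mulrC; apply: ler_pM => //; rewrite ?is_metric_ge0// ltW.
  have h1 := le_trans (pqN (inl x) (inr y) I I) (bound N N0 Ns).
  have h2 := le_trans (vN (inl x) (inr y) I I) (bound N' N'0 N's).
  apply: le_trans (opnorm_triangle (p' x) _ _) _.
  rewrite -mulrA mulr_natl mulr2n; apply: lerD.
    by rewrite opnormBC; exact: h1.
  by rewrite -vp; exact: h2.
(* From the given [q0] to the lift of [p0], along the lifted path, and back from
   the lift of [p1] to the given [q1]. *)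
have pathE (delta : R) : 2 * eps * s < delta -> delta < 1 ->
    exists v, is_path_in (lip_proj rho ((1 - delta)^-1 * s)) (dsum p0 q0) (dsum p1 q1) v.
  move=> d2 d1.
  have D0 : 0 <= 2 * e * s.
    exact: mulr_ge0 (mulr_ge0 (ler0n _ 2) (ltW e0)) (ltW s0).
  have Dd : 2 * e * s < delta.
    by apply: le_lt_trans d2; rewrite -!mulrA ler_pM2l// ler_pM2r// ltW.
  have d0 : 0 < delta by exact: le_lt_trans Dd.
  have sK : s <= (1 - delta)^-1 * s.
    apply: ler_peMl; first exact: ltW.
    by rewrite invf_ge1 ?subr_gt0// lerBlDr lerDl ltW.
  have [l0 l1] := (proj_dsum _ _ p0r q0s pq0, proj_dsum _ _ p1r q1s pq1).
  have w0X x : w 0 (inl x) = p0 x by rewrite wX// p0E.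
  have w1X x : w 1 (inl x) = p1 x by rewrite wX// p1E.
  have c0 := close_lip_proj_path dm l0 (wS 0 I0) D0 Dd d1 (close _ _ _ l0 (wS 0 I0) w0X).
  have c1 := close_lip_proj_path dm l1 (wS 1 I1) D0 Dd d1 (close _ _ _ l1 (wS 1 I1) w1X).
  apply: same_path_component_trans c0 _.
  apply: same_path_component_trans (same_path_component_sym c1).
  by apply: same_path_component_mono (lip_proj_mono sK) _; exists w.
split.
  move=> delta d2 d1; have [v vp] := pathE delta d2 d1.
  exists (fun t => v t \o inl), (fun t => v t \o inr); split.
  - exact: path_restrict dm rhoX vp.
  - exact: path_restrict dm rhoY vp.
  - move=> t t01; have -> : dsum (v t \o inl) (v t \o inr) = v t.
      by apply/funext => -[].
    by case: vp => _ _ /(_ t t01) [].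
(* As [2 eps s < 1], some admissible [delta] exists. *)
have [||v vp] := pathE ((2 * eps * s + 1) / 2); [lra|lra|].
apply: bundle_isomorphic_path; exists (fun t => v t \o inr).
exact: path_restrict dm rhoY vp.
Qed.
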